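(* Let $X$ be a Banach space and let $T \in L(X)$. Then the following properties are equivalent: (1) $T$ is a right semi-B-Fredholm operator, i.e. $\pi(T)$ is right Drazin invertible in $\mathcal{C}_0(X)$. (2) $T$ is a nilpotent-right semi-Fredholm operator, i.e. there exist closed $T$-invariant subspaces $M, N$ of $X$ with $X = M \oplus N$ such that $T_{\mid M}$ is nilpotent and $T_{\mid N} \in \Phi_r(N)$.
   Context: $L(X)$ is the Banach algebra of bounded linear operators on the Banach space $X$, $F_0(X)$ is the ideal of finite rank operators in $L(X)$, $\mathcal{C}_0(X) = L(X)/F_0(X)$ is the (purely algebraic) quotient algebra, and $\pi : L(X) \to \mathcal{C}_0(X)$ is the natural projection. Let $A$ be a ring with unit, and for $p \in A$ let $comm(p) = \{x \in A : xp = px\}$. For an idempotent $p \in A$, an element $a \in A$ is called right $p$-invertible if $ap = pa$ and $a + p$ is right invertible in $comm(p)$ (i.e. has a right inverse belonging to $comm(p)$). An element $a \in A$ is called right Drazin invertible if there exists an idempotent $p \in A$ such that $a$ is right $p$-invertible and $ap$ is nilpotent. For a Banach space $Y$ and $U \in L(Y)$, $N(U)$ and $R(U)$ denote the null space and range of $U$. $\Phi_r(Y)$ (the right semi-Fredholm operators on $Y$) is the set of $U \in L(Y)$ such that $R(U)$ is closed and of finite codimension in $Y$, and there exists a bounded projection of $Y$ onto $N(U)$. A subspace $M$ of $X$ is $T$-invariant if $T(M) \subset M$, and then $T_{\mid M} : M \to M$ is the restriction of $T$ to $M$. *)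

(* Defs.v *)
From HB Require Import structures.
From mathcomp Require Import all_boot all_order all_algebra.
From mathcomp Require Import complex.
From mathcomp Require Import all_classical all_reals all_analysis.

Set Implicit Arguments.
Unset Strict Implicit.
Unset Printing Implicit Defensive.

Import Order.TTheory GRing.Theory Num.Theory.
Import numFieldNormedType.Exports.

Local Open Scope classical_set_scope.
Local Open Scope quotient_scope.
Local Open Scope ring_scope.

Section RightDrazin.
Variable A : pzRingType.

Definition commutant (p : A) : set A := [set x | GRing.comm x p].

Definition right_p_invertible (p a : A) : Prop :=
  GRing.comm a p /\ exists2 b, commutant p b & (a + p) * b = 1.

Definition is_nilpotent (a : A) : Prop := exists n, a ^+ n = 0.

Definition right_drazin_invertible (a : A) : Prop :=
  exists p : A, [/\ p * p = p, right_p_invertible p a & is_nilpotent (a * p)].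

End RightDrazin.

Section FiniteDimension.
Variables (K : fieldType) (V : lmodType K).

Definition lspan n (v : 'I_n -> V) : set V :=
  range (fun c : 'I_n -> K => \sum_i c i *: v i).

Definition finite_dim (S : set V) : Prop :=
  exists n (v : 'I_n -> V), S = lspan v.

(* V / S is spanned by the classes of finitely many vectors *)
Definition finite_codim (S : set V) : Prop :=
  exists n (v : 'I_n -> V), forall y, exists2 s, S s & lspan v (y - s).

Lemma lspan0 n (v : 'I_n -> V) : lspan v 0.
Proof. by exists (fun=> 0) => //; rewrite big1// => i _; rewrite scale0r. Qed.

Lemma lspan_lin n (v : 'I_n -> V) a x y :
  lspan v x -> lspan v y -> lspan v (a *: x + y).
Proof.
move=> [c _ <-] [d _ <-]; exists (fun i => a * c i + d i) => //.
rewrite scaler_sumr -big_split /=; apply: eq_bigr => i _.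
by rewrite scalerDl scalerA.
Qed.

Lemma finite_dim_sub n (v : 'I_n -> V) (S : set V) :
  S 0 -> (forall a x y, S x -> S y -> S (a *: x + y)) ->
  S `<=` lspan v -> finite_dim S.
Proof.
elim: n v S => [|n IHn] v S S0 Sl Sv.
  exists 0%N, v; apply/seteqP; split=> // x [c _ <-].
  by rewrite big_ord0.
pose w i := v (lift ord0 i).
have [S' |/existsNP[s /not_implyP[Ss nws]]] := pselect (S `<=` lspan w).
  exact: (IHn w).
have [c _ cs] := Sv _ Ss; rewrite big_ord_recl /= in cs.
have c0 : c ord0 != 0.
  apply: contra_notN nws => /eqP c0; exists (fun i => c (lift ord0 i)) => //.
  by rewrite -cs c0 scale0r add0r.
have [||//|m [u Su]] := IHn w (S `&` lspan w).
- by split=> //; exact: lspan0.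
- by move=> a x y [? ?] [? ?]; split; [exact: Sl|exact: lspan_lin].
pose z (i : 'I_m.+1) := if unlift ord0 i is Some j then u j else s.
have uS x : lspan u x -> S x by rewrite -Su => -[].
exists m.+1, z; apply/seteqP; split => x.
  move=> Sx; have [d _ dx] := Sv _ Sx; rewrite big_ord_recl /= in dx.
  have : lspan u (x - (d ord0 / c ord0) *: s).
    rewrite -Su; split; first by rewrite addrC -scaleNr; exact: Sl.
    exists (fun i => d (lift ord0 i) - d ord0 / c ord0 * c (lift ord0 i)) => //.
    rewrite -dx -cs scalerDr scalerA divfK// opprD addrACA subrr add0r.
    rewrite scaler_sumr -sumrB; apply: eq_bigr => i _.
    by rewrite scalerBl scalerA.
  move=> [e _ ex].
  exists (fun i => if unlift ord0 i is Some j then e j else d ord0 / c ord0) => //.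
  rewrite big_ord_recl /z /= unlift_none.
  under eq_bigr do rewrite liftK.
  by rewrite ex addrC subrK.
move=> [e _ <-]; rewrite big_ord_recl /z /= unlift_none.
under eq_bigr do rewrite liftK.
by apply: Sl => //; apply: uS; exists (fun i => e (lift ord0 i)).
Qed.

End FiniteDimension.

Section BoundedOperators.
Variables (K : numFieldType) (X : normedModType K).

Definition bounded_op (f : X -> X) : Prop :=
  exists M : K, forall x, `|f x| <= M * `|x|.

(* Equivalent to continuous: see bop_continuous, continuous_bounded_op. *)
Record bop := Bop {
  bop_fun :> X -> X;
  bop_linear : linear bop_fun;
  bop_bounded : bounded_op bop_fun }.

End BoundedOperators.

Notation "''L' ( X )" := (bop X) (at level 8, format "''L' ( X )") : type_scope.

Section BopRing.
Variables (K : numFieldType) (X : normedModType K).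
Implicit Types f g h : 'L(X).

HB.instance Definition _ f :=
  GRing.isLinear.Build K X X _ (bop_fun f) (bop_linear f).

HB.instance Definition _ := gen_eqMixin 'L(X).
HB.instance Definition _ := gen_choiceMixin 'L(X).

Lemma bopP f g : (forall x, f x = g x) -> f = g.
Proof.
case: f g => [f lf bf] [g lg bg] /= /funext fg; rewrite -{}fg in lg bg *.
by rewrite (Prop_irrelevance lf lg) (Prop_irrelevance bf bg).
Qed.

Lemma bop_bound f : exists2 M : K, 0 <= M & forall x, `|f x| <= M * `|x|.
Proof.
have [M fM] := bop_bounded f; exists `|M| => // x.
by rewrite -[X in _ * X]normr_id -normrM (le_trans (fM x))// real_ler_norm//
           ger0_real// (le_trans _ (fM x)).
Qed.

Lemma bop_continuous f : continuous f.
Proof.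
apply/linear_bounded_continuous/linear_boundedP; have [M M0 fM] := bop_bound f.
near=> r => x; apply: (le_trans (fM x)); rewrite ler_wpM2r//.
by near: r; apply: nbhs_pinfty_ge; exact: ger0_real.
Unshelve. all: by end_near. Qed.

Lemma continuous_bounded_op (f : {linear X -> X}) :
  continuous f -> bounded_op f.
Proof.
move=> /linear_bounded_continuous/linear_boundedP/pinfty_ex_gt0[M _ fM].
by exists M.
Qed.

Let zero_linear : linear (fun _ : X => 0 : X).
Proof. by move=> a x y; rewrite scaler0 addr0. Qed.
Let zero_bounded : bounded_op (fun _ : X => 0 : X).
Proof. by exists 0 => x; rewrite normr0 mul0r. Qed.
Definition bop_zero : 'L(X) := Bop zero_linear zero_bounded.

Let opp_linear f : linear (fun x => - f x).
Proof. by move=> a x y; rewrite linearP opprD scalerN. Qed.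
Let opp_bounded f : bounded_op (fun x => - f x).
Proof. by have [M fM] := bop_bounded f; exists M => x; rewrite normrN. Qed.
Definition bop_opp f : 'L(X) := Bop (opp_linear f) (opp_bounded f).

Let add_linear f g : linear (fun x => f x + g x).
Proof. by move=> a x y; rewrite !linearP scalerDr addrACA. Qed.
Let add_bounded f g : bounded_op (fun x => f x + g x).
Proof.
have [M fM] := bop_bounded f; have [N gN] := bop_bounded g.
by exists (M + N) => x; rewrite mulrDl (le_trans (ler_normD _ _))// lerD.
Qed.
Definition bop_add f g : 'L(X) := Bop (add_linear f g) (add_bounded f g).

Let one_linear : linear (fun x : X => x).
Proof. by []. Qed.
Let one_bounded : bounded_op (fun x : X => x).
Proof. by exists 1 => x; rewrite mul1r. Qed.
Definition bop_one : 'L(X) := Bop one_linear one_bounded.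

Let mul_linear f g : linear (fun x => f (g x)).
Proof. by move=> a x y; rewrite !linearP. Qed.
Let mul_bounded f g : bounded_op (fun x => f (g x)).
Proof.
have [M M0 fM] := bop_bound f; have [N gN] := bop_bounded g.
exists (M * N) => x; rewrite (le_trans (fM _))// -mulrA.
by rewrite ler_wpM2l.
Qed.
Definition bop_mul f g : 'L(X) := Bop (mul_linear f g) (mul_bounded f g).

Let addA : associative bop_add.
Proof. by move=> f g h; apply: bopP => x /=; rewrite addrA. Qed.
Let addC : commutative bop_add.
Proof. by move=> f g; apply: bopP => x /=; rewrite addrC. Qed.
Let add0 : left_id bop_zero bop_add.
Proof. by move=> f; apply: bopP => x /=; rewrite add0r. Qed.
Let addN : left_inverse bop_zero bop_opp bop_add.
Proof. by move=> f; apply: bopP => x /=; rewrite addNr. Qed.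
HB.instance Definition _ := GRing.isZmodule.Build 'L(X) addA addC add0 addN.

Let mulA : associative bop_mul.
Proof. by move=> f g h; apply: bopP. Qed.
Let mul1 : left_id bop_one bop_mul.
Proof. by move=> f; apply: bopP. Qed.
Let mulr1' : right_id bop_one bop_mul.
Proof. by move=> f; apply: bopP. Qed.
Let mulDl : left_distributive bop_mul +%R.
Proof. by move=> f g h; apply: bopP. Qed.
Let mulDr : right_distributive bop_mul +%R.
Proof. by move=> f g h; apply: bopP => x /=; rewrite linearD. Qed.
HB.instance Definition _ :=
  GRing.Zmodule_isPzRing.Build 'L(X) mulA mul1 mulr1' mulDl mulDr.

Definition finite_rank : {pred 'L(X)} := fun f => `[< finite_dim (range f) >].

Lemma finite_rankP f :
  reflect (exists n (v : 'I_n -> X), range f `<=` lspan v) (f \in finite_rank).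
Proof.
apply: (iffP idP) => [/asboolP[n [v ->]]|[n [v fv]]]; first by exists n, v.
apply/asboolP/(finite_dim_sub _ _ fv); first by exists 0 => //; rewrite linear0.
by move=> a _ _ [x _ <-] [y _ <-]; exists (a *: x + y) => //; rewrite linearP.
Qed.

Let finite_rank_zmod : zmod_closed finite_rank.
Proof.
split=> [|f g /finite_rankP[m [v fv]] /finite_rankP[n [w gw]]].
  apply/finite_rankP; exists 0%N, (fun=> 0) => _ [x _ <-].
  by exists (fun=> 0) => //; rewrite big_ord0.
apply/finite_rankP.
exists (m + n)%N, (fun i => match fintype.split i with inl j => v j | inr j => w j end).
move=> _ [x _ <-].
have [|c _ cE] := fv (f x); first by exists x.
have [|d _ dE] := gw (g x); first by exists x.
exists (fun i => match fintype.split i with inl j => c j | inr j => - d j end) => //.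
rewrite big_split_ord /=; under eq_bigr do rewrite (unsplitK (inl _)).
under [X in _ + X]eq_bigr do rewrite (unsplitK (inr _)) scaleNr.
by rewrite sumrN cE dE.
Qed.
HB.instance Definition _ :=
  GRing.isZmodClosed.Build 'L(X) finite_rank finite_rank_zmod.

Lemma finite_rankMl f g : g \in finite_rank -> f * g \in finite_rank.
Proof.
move=> /finite_rankP[n [v gv]]; apply/finite_rankP; exists n, (f \o v).
move=> _ [x _ <-]; have [|c _ cE] := gv (g x); first by exists x.
exists c => //; transitivity (f (\sum_i c i *: v i)); last by rewrite cE.
by rewrite linear_sum; apply: eq_bigr => i _; rewrite linearZ.
Qed.

Lemma finite_rankMr f g : f \in finite_rank -> f * g \in finite_rank.
Proof.
move=> /finite_rankP[n [v fv]]; apply/finite_rankP; exists n, v.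
by move=> _ [x _ <-]; apply: fv; exists (g x).
Qed.

(* The library equips a quotient with a product only for commutative rings,
   so only its quotient group is reused.  The result is a pzRingType because
   1 = 0 in it when X is finite-dimensional. *)
Definition frquot : Type := {ideal_quot finite_rank}.
HB.instance Definition _ := GRing.Zmodule.on frquot.

Definition frquot_pi : 'L(X) -> frquot := \pi_({ideal_quot finite_rank}).

Lemma frquot_piP f g : frquot_pi f = frquot_pi g <-> f - g \in finite_rank.
Proof. by rewrite Quotient.idealrBE; split=> [fg|/eqP//]; exact/eqP. Qed.

Lemma frquot_pi_surj (a : frquot) : exists f, a = frquot_pi f.
Proof. by exists (repr a); rewrite /frquot_pi reprK. Qed.

Lemma frquot_pi_is_zmod_morphism : zmod_morphism frquot_pi.
Proof. by move=> f g; rewrite /frquot_pi -raddfB. Qed.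
HB.instance Definition _ :=
  GRing.isZmodMorphism.Build 'L(X) frquot frquot_pi frquot_pi_is_zmod_morphism.

Definition frquot_one : frquot := frquot_pi 1.
Definition frquot_mul (a b : frquot) : frquot :=
  frquot_pi (repr a * repr b).

Lemma frquot_piM f g : frquot_mul (frquot_pi f) (frquot_pi g) = frquot_pi (f * g).
Proof.
rewrite /frquot_mul; set f' := repr _; set g' := repr _; apply/frquot_piP.
have ff : f' - f \in finite_rank by apply/frquot_piP; rewrite /frquot_pi reprK.
have gg : g' - g \in finite_rank by apply/frquot_piP; rewrite /frquot_pi reprK.
have -> : f' * g' - f * g = (f' - f) * g' + f * (g' - g).
  by rewrite mulrBl mulrBr addrA subrK.
by apply: rpredD; [exact: finite_rankMr|exact: finite_rankMl].
Qed.

Let cmulA : associative frquot_mul.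
Proof.
move=> a b c; have [f ->] := frquot_pi_surj a; have [g ->] := frquot_pi_surj b.
by have [h ->] := frquot_pi_surj c; rewrite !frquot_piM mulrA.
Qed.
Let cmul1 : left_id frquot_one frquot_mul.
Proof. by move=> a; have [f ->] := frquot_pi_surj a; rewrite frquot_piM mul1r. Qed.
Let cmulr1 : right_id frquot_one frquot_mul.
Proof. by move=> a; have [f ->] := frquot_pi_surj a; rewrite frquot_piM mulr1. Qed.
Let cmulDl : left_distributive frquot_mul +%R.
Proof.
move=> a b c; have [f ->] := frquot_pi_surj a; have [g ->] := frquot_pi_surj b.
by have [h ->] := frquot_pi_surj c; rewrite -raddfD !frquot_piM mulrDl raddfD.
Qed.
Let cmulDr : right_distributive frquot_mul +%R.
Proof.
move=> a b c; have [f ->] := frquot_pi_surj a; have [g ->] := frquot_pi_surj b.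
by have [h ->] := frquot_pi_surj c; rewrite -raddfD !frquot_piM mulrDr raddfD.
Qed.
HB.instance Definition _ :=
  GRing.Zmodule_isPzRing.Build frquot cmulA cmul1 cmulr1 cmulDl cmulDr.

Lemma frquot_pi_is_monoid_morphism : monoid_morphism frquot_pi.
Proof. by split=> // f g; rewrite -frquot_piM. Qed.
HB.instance Definition _ := GRing.isMonoidMorphism.Build 'L(X) frquot frquot_pi
  frquot_pi_is_monoid_morphism.

End BopRing.

Section ClosedSubspace.
Variables (K : numFieldType) (X : completeNormedModType K).

Record closed_subspace := ClosedSubspace {
  csub_pred :> submodClosed X;
  csub_closed : closed [set x : X | x \in csub_pred] }.

Record csub (S : closed_subspace) := Csub {
  csub_val : X;
  csub_valP : csub_val \in csub_pred S }.

End ClosedSubspace.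

Section ClosedSubspaceBanach.
Variables (K : numFieldType) (X : completeNormedModType K).
Variable S : closed_subspace X.

HB.instance Definition _ := [isSub for @csub_val K X S].
HB.instance Definition _ := [Choice of csub S by <:].
HB.instance Definition _ := [SubChoice_isSubLmodule of csub S by <:].

Let csub_norm (x : csub S) : K := `|val x|.
Let csub_normD x y : csub_norm (x + y) <= csub_norm x + csub_norm y.
Proof. exact: ler_normD. Qed.
Let csub_normZ a x : csub_norm (a *: x) = `|a| * csub_norm x.
Proof. by rewrite /csub_norm linearZ normrZ. Qed.
Let csub_norm_eq0 x : csub_norm x = 0 -> x = 0.
Proof. by move=> /normr0_eq0 x0; apply: val_inj; rewrite x0 linear0. Qed.
HB.instance Definition _ :=
  Lmodule_isNormed.Build K (csub S) csub_normD csub_normZ csub_norm_eq0.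

Lemma csub_normE (x : csub S) : `|x| = `|val x|.
Proof. by []. Qed.

Let csub_complete (F : set_system (csub S)) :
  ProperFilter F -> cauchy F -> cvg F.
Proof.
move=> FF /cauchy_ballP Fc.
have : cauchy ((val : csub S -> X) @ F).
  apply/cauchy_ballP => e e0; have := Fc _ e0; rewrite !near_simpl.
  move=> [[P Q] /= [FP FQ] PQ]; exists (val @` P, val @` Q).
    split; first by apply: filterS FP => x Px; exists x.
    by apply: filterS FQ => x Qx; exists x.
  move=> [_ _] /= [[x Px <-] [y Qy <-]].
  by have := PQ (x, y) (conj Px Qy); rewrite /= -!ball_normE /=.
move=> /cauchy_cvg /cvg_ex[l Fl].
have Sl : l \in csub_pred S.
  apply: (@closed_cvg _ _ F _ (val : csub S -> X) _ (@csub_closed _ _ S)) Fl.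
  by apply: nearW => x; exact: (csub_valP x).
apply/cvg_ex; exists (Csub Sl); apply/cvgrPdist_lt => e e0.
by move/cvgrPdist_lt : Fl => /(_ e e0).
Qed.
HB.instance Definition _ := Uniform_isComplete.Build (csub S) csub_complete.

Variable T : 'L(X).

Definition bop_invariant : Prop := forall x, x \in csub_pred S -> T x \in csub_pred S.

Hypothesis TS : bop_invariant.

Definition restrict_fun (x : csub S) : csub S := Csub (TS (csub_valP x)).

Let restrict_linear : linear restrict_fun.
Proof. by move=> a x y; apply: val_inj; rewrite /= !linearP. Qed.
Let restrict_bounded : bounded_op restrict_fun.
Proof. by have [M TM] := bop_bounded T; exists M => x; exact: TM. Qed.
Definition bop_restrict : 'L(csub S) := Bop restrict_linear restrict_bounded.

End ClosedSubspaceBanach.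

Section RightSemiFredholm.
Variables (K : numFieldType).

Definition ker_op (Y : normedModType K) (U : 'L(Y)) : set Y :=
  [set y | U y = 0].

Definition right_semi_Fredholm (Y : completeNormedModType K) (U : 'L(Y)) : Prop :=
  [/\ closed (range U), finite_codim (range U) &
      exists2 P : 'L(Y), P * P = P & range P = ker_op U].

Variable X : completeNormedModType K.

Definition direct_sum (M N : closed_subspace X) : Prop :=
  (forall x, exists2 m, m \in csub_pred M &
     exists2 n, n \in csub_pred N & x = m + n) /\
  (forall x, x \in csub_pred M -> x \in csub_pred N -> x = 0).

Definition right_semi_B_Fredholm (T : 'L(X)) : Prop :=
  right_drazin_invertible (frquot_pi T).

Definition nilpotent_right_semi_Fredholm (T : 'L(X)) : Prop :=
  exists (M N : closed_subspace X) (TM : bop_invariant M T) (TN : bop_invariant N T),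
    [/\ direct_sum M N, is_nilpotent (bop_restrict TM)
      & right_semi_Fredholm (bop_restrict TN)].

End RightSemiFredholm.

(* The norm of a normedModType K takes its values in K: over R[i] it is a
   nonnegative real embedded in R[i]. *)
Variant real_or_complex (R : realType) : numFieldType -> Prop :=
  | RealScalars : real_or_complex R R
  | ComplexScalars : real_or_complex R R[i].

(* Main.v *)
Require Import Defs.
From HB Require Import structures.
From mathcomp Require Import all_boot all_order all_algebra.
From mathcomp Require Import complex.
From mathcomp Require Import all_classical all_reals all_analysis.
From mathcomp Require Import ring lra.

(** Write ~ for equality of operators modulo finite rank.

    From a decomposition X = M (+) N to right Drazin invertibility.  The open
    mapping theorem makes the projection E onto M along N bounded, and gives the
    right semi-Fredholm operator T|N a bounded right inverse b modulo finite
    rank.  As T|M is nilpotent, T + 1 is inverted on M by a finite geometric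
    sum; this sum on M together with b on N is a right inverse of T + E modulo
    finite rank that commutes with E.

    From right Drazin invertibility to a decomposition.  The hypothesis provides
    P and S with P P ~ P, P T ~ T P, T^n P ~ 0 and T S (1 - P) ~ 1 - P.  The task
    is to find an idempotent E ~ P that commutes with T exactly, with T^m E = 0:
    then T restricted to ker E still has a right inverse modulo finite rank, and
    such operators are right semi-Fredholm.  Everything rests on one fact: a
    finite-rank operator has bounded coordinates (Hahn-Banach), so that it can
    be lifted through any operator through which it lifts pointwise, and is in
    particular von Neumann regular.

    An idempotent E ~ P whose range M is T-invariant with T nilpotent on it is
    obtained by cutting the range of an idempotent lift of P by finitely many
    finite-rank conditions.  What remains is the coupling C = E T (1 - E), of
    finite rank, between a complement of M and M.  It cannot simply be split off
    together with a finite-dimensional T-invariant piece of M, because such a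
    piece need not have a closed T-invariant complement in M.  Instead:

    - M is enlarged (nilpotent_projection_saturate) until every vector killed by
      a power of T lies in range T + M;
    - the complement of M is tilted (couple_through_kernel) so that C factors
      through the kernel of the compression B of T to the complement; this part
      of C is the only one that a generalised inverse of B does not remove;
    - the finite-dimensional T-invariant space Z generated by range C is then
      moved from M into the complement, which becomes T-invariant.  By the
      first two steps Z lies in a space V of nilpotent vectors with V = T V, so
      all the vectors of Z have iterated preimages in the new complement; these
      allow what is left of M to be tilted (lower_triangular_splitting) until it
      is T-invariant too. *)

Set Implicit Arguments.
Unset Strict Implicit.
Unset Printing Implicit Defensive.

Import Order.TTheory GRing.Theory Num.Theory.
Import numFieldNormedType.Exports.

Local Open Scope classical_set_scope.
Local Open Scope ring_scope.

(** * Bounded functionals *)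
Section HahnBanach.
Variables (R : realType) (K : numFieldType) (iota : {rmorphism R -> K}).
Variables (V : lmodType K) (p : V -> R).
Hypothesis pD : forall x y, p (x + y) <= p x + p y.
Hypothesis pZ : forall a x, p (iota a *: x) = `|a| * p x.

(** Partial functionals are encoded by their graphs: a chain of graphs has its
    union as upper bound, and a dominated linear relation is automatically a
    graph.  The scalars act through iota, so that the same argument covers real
    and complex spaces. *)
Definition rlinear_rel (G : set (V * R)) : Prop :=
  forall a u w, G u -> G w -> G (iota a *: u.1 + w.1, a * u.2 + w.2).

Definition dominated_rel (G : set (V * R)) : Prop :=
  rlinear_rel G /\ forall u, G u -> u.2 <= p u.1.

Let p0 : p 0 = 0.
Proof. by have := pZ 0 0; rewrite scaler0 normr0 mul0r. Qed.

Lemma dominated_rel_fun (G : set (V * R)) : dominated_rel G ->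
  forall x r s, G (x, r) -> G (x, s) -> r = s.
Proof.
move=> [linG domG].
have le0 x r s : G (x, r) -> G (x, s) -> s <= r.
  move=> Gr Gs; have /domG /= := linG (-1) _ _ Gr Gs.
  by rewrite rmorphN1 scaleN1r addNr p0 mulN1r addrC subr_le0.
by move=> x r s Gr Gs; apply/le_anti; rewrite !(le0 x).
Qed.

(** A value c is admissible at x0 as soon as
    r - p (x - x0) <= c <= p (y + x0) - s for all (x, r) and (y, s) in G, and
    the subadditivity of p leaves room for such a c. *)
Lemma dominated_rel_extend (G : set (V * R)) (x0 : V) :
    dominated_rel G -> G (0, 0) ->
  exists c, dominated_rel
    [set u | exists t w, G w /\ u = (w.1 + iota t *: x0, w.2 + t * c)].
Proof.
move=> [linG domG] G0.
pose lo := [set w.2 - p (w.1 - x0) | w in G].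
have lo_le (w : V * R) : G w -> ubound lo (p (w.1 + x0) - w.2).
  move=> Gw _ [u Gu <-]; rewrite lerBrDr addrAC lerBlDr.
  have := domG _ (linG 1 _ _ Gu Gw); rewrite /= rmorph1 scale1r mul1r.
  move=> /le_trans; apply.
  have -> : u.1 + w.1 = (w.1 + x0) + (u.1 - x0).
    by rewrite addrACA subrr addr0 addrC.
  exact: pD.
have lo_sup : has_sup lo.
  split; first by exists (0 - p (0 - x0)), (0, 0).
  by exists (p (0 + x0) - 0); exact: (lo_le (0, 0)).
have lo_c w : G w -> w.2 - p (w.1 - x0) <= sup lo.
  by move=> Gw; apply: ub_le_sup; [case: lo_sup|exists w].
have c_hi w : G w -> sup lo <= p (w.1 + x0) - w.2.
  by move=> Gw; apply: ge_sup; [case: lo_sup|exact: lo_le].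
have Gscale a w : G w -> G (iota a *: w.1, a * w.2).
  by move=> Gw; have := linG a _ _ Gw G0; rewrite /= !addr0.
have pZ0 a x : 0 <= a -> p (iota a *: x) = a * p x.
  by move=> a0; rewrite pZ ger0_norm.
exists (sup lo); split.
  move=> a _ _ [t [u [Gu ->]]] [s [w [Gw ->]]].
  exists (a * t + s), (iota a *: u.1 + w.1, a * u.2 + w.2).
  split; first exact: linG.
  rewrite /= rmorphD rmorphM scalerDl scalerDr scalerA mulrDr mulrDl mulrA.
  by rewrite addrACA [X in (_, X)]addrACA.
move=> _ [t [w [Gw ->]]] /=.
have [t0|t0|->] := ltgtP t 0; last first.
- by rewrite rmorph0 scale0r mul0r !addr0; exact: domG.
- have := c_hi _ (Gscale t^-1 _ Gw); rewrite /= lerBrDr -(ler_pM2l t0).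
  rewrite -(pZ0 _ _ (ltW t0)) scalerDr scalerA -rmorphM mulrDr mulrA.
  rewrite divff ?gt_eqF//.
  by rewrite rmorph1 scale1r mul1r addrC.
- have nt0 : 0 < - t by rewrite oppr_gt0.
  have := lo_c _ (Gscale (- t)^-1 _ Gw); rewrite /= lerBlDr -(ler_pM2l nt0).
  rewrite mulrDr -(pZ0 _ _ (ltW nt0)) scalerBr !scalerA -rmorphM mulrA.
  rewrite divff ?gt_eqF// rmorph1 scale1r mul1r mulNr addrC -lerBlDr opprK.
  by rewrite rmorphN scaleNr opprK.
Qed.

Theorem Hahn_Banach (v : V) : exists f : V -> R,
  [/\ forall a x y, f (iota a *: x + y) = a * f x + f y,
      forall x, `|f x| <= p x & f v = p v].
Proof.
have p_ge0 x : 0 <= p x.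
  have := pD x (- x); have := pZ (-1) x.
  rewrite rmorphN1 scaleN1r normrN1 mul1r subrr p0 => ->.
  by rewrite -mulr2n pmulrn_lge0.
pose base := [set (iota t *: v, t * p v) | t in [set: R]].
have base0 : base (0, 0) by exists 0 => //; rewrite rmorph0 scale0r mul0r.
have base_dom : dominated_rel base.
  split=> [a _ _ [t _ <-] [s _ <-]|_ [t _ <-]] /=.
    exists (a * t + s) => //=.
    by rewrite rmorphD rmorphM scalerDl scalerA mulrDl mulrA.
  by rewrite pZ ler_wpM2r// ler_norm.
(* the line through v is joined to each graph from outside, so that the empty
   chain is bounded too *)
have [|A [Adom Amax]] := @Zorn_bigcup _ [set G | dominated_rel (G `|` base)].
  move=> F Fdom Ftot; split; last first.
    by move=> u [[G FG Gu]|/base_dom.2//]; apply: (Fdom _ FG).2; left.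
  have FU G : F G -> G `|` base `<=` \bigcup_(X in F) X `|` base.
    by move=> FG; apply: setSU; exact: bigcup_sup.
  move=> a u w [[G FG Gu]|bu] [[H FH Hw]|bw].
  - have [GH|HG] := Ftot _ _ FG FH.
      by apply: (FU _ FH); apply: (Fdom _ FH).1; left => //; exact: GH.
    by apply: (FU _ FG); apply: (Fdom _ FG).1; left => //; exact: HG.
  - by apply: (FU _ FG); apply: (Fdom _ FG).1; [left|right].
  - by apply: (FU _ FH); apply: (Fdom _ FH).1; [right|left].
  - by right; apply: base_dom.1.
set G := A `|` base in Adom.
have G0 : G (0, 0) by right.
have total x : exists r, G (x, r).
  have [c Bdom] := dominated_rel_extend x Adom G0.
  set B := [set u | _] in Bdom.
  have GB : G `<=` B.
    move=> [y s] Gy; exists 0, (y, s).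
    by rewrite rmorph0 scale0r mul0r /= !addr0.
  have Bbase : B `|` base = B by apply/setUidPl => u bu; apply: GB; right.
  apply: contrapT => /forallNP nG; apply: (Amax B); last by rewrite /= Bbase.
  split; first by move=> u Au; apply: GB; left.
  move=> BA; apply: (nG c); left; apply: BA.
  by exists 1, (0, 0); rewrite rmorph1 scale1r mul1r /= !add0r.
have [f Gf] := choice total.
have fun_G := dominated_rel_fun Adom.
have f_lin a x y : f (iota a *: x + y) = a * f x + f y.
  exact: (fun_G _ _ _ (Gf _) (Adom.1 a _ _ (Gf x) (Gf y))).
have f_le x : f x <= p x by exact: (Adom.2 _ (Gf x)).
exists f; split=> //.
  move=> x; rewrite ler_norml f_le andbT lerNl.
  have := f_lin (-1) x 0; have := f_le (- x); have := pZ (-1) x.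
  have -> : f 0 = 0 by exact: (fun_G _ _ _ (Gf _) G0).
  by rewrite rmorphN1 scaleN1r !addr0 mulN1r normrN1 mul1r => -> + <-.
apply: (fun_G _ _ _ (Gf _)); right.
by exists 1 => //; rewrite rmorph1 scale1r mul1r.
Qed.

End HahnBanach.

(** The norm of a space over R[i] takes values in R[i], so the seminorm fed to
    the real theorem is the real part of the norm. *)
Theorem norming_functional (R : realType) (K : numFieldType)
    (hK : real_or_complex R K) (X : normedModType K) (v : X) : v != 0 ->
  exists phi : X -> K,
    [/\ scalar phi, exists M : K, forall x, `|phi x| <= M * `|x| & phi v = 1].
Proof.
case: hK X v => X v v0.
  have [//||f [f_lin f_le fv]] := @Hahn_Banach R R idfun X Num.norm _ _ v.
  - exact: ler_normD.
  - by move=> a x; rewrite normrZ.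
  have nv0 : `|v| != 0 by rewrite normr_eq0.
  exists (fun x => f x / `|v|); split.
  - by move=> a x y; rewrite f_lin mulrDl mulrA.
  - exists `|v|^-1 => x; rewrite normrM normfV normr_id mulrC.
    by rewrite ler_wpM2l ?invr_ge0.
  - by rewrite fv divff.
pose re : R[i] -> R := @complex.Re R.
have normE (x : X) : (re `|x|)%:C%C = `|x| by rewrite RRe_real// normr_real.
have [||f [f_lin f_le fv]] := @Hahn_Banach R R[i]
  (real_complex R) X (fun x => re `|x|) _ _ v.
- move=> x y; rewrite -lecR rmorphD /= !normE; exact: ler_normD.
- move=> a x; apply: complexI; rewrite rmorphM /= !normE normrZ.
  by rewrite normc_def /= expr0n addr0 sqrtr_sqr.
have f_add x y : f (x + y) = f x + f y.
  by have := f_lin 1 x y; rewrite rmorph1 scale1r mul1r.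
have f_scale a x : f (a%:C%C *: x) = a * f x.
  have f0 : f 0 = 0 by apply: (addrI (f 0)); rewrite -f_add !addr0.
  by have := f_lin a x 0; rewrite f0 !addr0.
have f_opp x : f (- x) = - f x.
  by have := f_scale (-1) x; rewrite rmorphN1 scaleN1r mulN1r.
(* the complex functional whose real part is f *)
pose g x : R[i] := (f x +i* - f ('i%C *: x))%C.
have g_add x y : g (x + y) = g x + g y.
  by rewrite /g scalerDr !f_add opprD.
have g_scale a x : g (a *: x) = a * g x.
  case: a => a b.
  have fab y : f ((a +i* b)%C *: y) = a * f y + b * f ('i%C *: y).
    rewrite [(a +i* b)%C]complexE /= scalerDl f_add f_scale.
    by rewrite ['i%C * _]mulrC -scalerA f_scale.
  have ii y : 'i%C *: ('i%C *: y) = - y :> X.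
    by rewrite scalerA -expr2 sqr_i scaleN1r.
  rewrite /g fab scalerA ['i%C * _]mulrC -scalerA fab ii f_opp; simpc.
  by congr (_ +i* _)%C; lra.
have normr_i : `|'i%C : R[i]| = 1.
  by rewrite normc_def /= expr0n expr1n add0r sqrtr1.
have f_norm x : `|(f x)%:C%C| <= `|x|.
  rewrite -normE normc_def /= expr0n addr0 sqrtr_sqr lecR.
  exact: f_le.
have g_norm x : `|g x| <= 2 * `|x|.
  have -> : g x = (f x)%:C%C - 'i%C * (f ('i%C *: x))%:C%C.
    by rewrite [LHS]complexE /= rmorphN mulrN.
  rewrite (le_trans (ler_normB _ _))// mulrDl mul1r lerD//.
  by rewrite normrM normr_i mul1r (le_trans (f_norm _))// normrZ normr_i mul1r.
have gv0 : g v != 0.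
  apply: contra v0 => /eqP[fv0 _]; rewrite -normr_eq0 -normE -fv fv0.
  exact/eqP.
exists (fun x => g x / g v); split.
- by move=> a x y; rewrite g_add g_scale mulrDl mulrA.
- exists (`|g v|^-1 * 2) => x; rewrite normrM normfV mulrC -mulrA.
  by rewrite ler_wpM2l ?invr_ge0.
- by rewrite divff.
Qed.

(** * The open mapping theorem *)

(** Norms take their values in K; R[i] is only partially ordered, but its
    nonnegative elements are real, so that they inherit the archimedean property
    of R. *)
Lemma exists_natr_gt (R : realType) (K : numFieldType)
    (hK : real_or_complex R K) (x : K) : 0 <= x -> exists n, x < n%:R.
Proof.
case: hK x => x x0.
  by exists (Num.bound x); exact: archi_boundP.
have xE : x = (complex.Re x)%:C%C by rewrite RRe_real// ger0_real.
exists (Num.bound (complex.Re x)).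
rewrite xE -[_%:R](rmorph_nat (real_complex R)).
by rewrite ltcR archi_boundP// -lecR -xE.
Qed.

Lemma exists_half_exp_lt (R : realType) (K : numFieldType)
    (hK : real_or_complex R K) (e : K) : 0 < e -> exists n, 2^-1 ^+ n < e.
Proof.
move=> e0; have [|n en] := exists_natr_gt hK (x := e^-1).
  by rewrite invr_ge0 ltW.
have n0 : 0 < n%:R :> K by rewrite (le_lt_trans _ en)// invr_ge0 ltW.
exists n; rewrite exprVn -[e]invrK ltf_pV2 ?posrE ?exprn_gt0 ?invr_gt0//.
by rewrite (lt_trans en)// -natrX ltr_nat ltn_expl.
Qed.

Lemma le0_half_exp (R : realType) (K : numFieldType)
    (hK : real_or_complex R K) (x c : K) :
  0 <= c -> (forall n, x <= c * 2^-1 ^+ n) -> x <= 0.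
Proof.
move=> c0 xc; apply/ler_addgt0Pr => e e0; rewrite add0r.
have c1 : 0 < c + 1 by rewrite ltr_wpDl.
have [|n ne] := exists_half_exp_lt hK (e := e / (c + 1)).
  by rewrite divr_gt0.
rewrite ltr_pdivlMr// mulrC in ne; rewrite (le_trans (xc n))//.
apply: le_trans (ltW ne).
by rewrite ler_wpM2r ?lerDl// exprn_ge0// invr_ge0.
Qed.

Lemma halving_le (K : numFieldType) (a : nat -> K) :
  (forall n, a n.+1 <= a n / 2) -> forall n m, a (n + m)%N <= a n * 2^-1 ^+ m.
Proof.
move=> a2 n; elim=> [|m IHm]; first by rewrite addn0 mulr1.
by rewrite addnS exprSr mulrA (le_trans (a2 _))// ler_wpM2r// invr_ge0.
Qed.

(** The step bounds form a halving sequence, rather than a fixed geometric one,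
    so that the distance to the limit is controlled by the current bound. *)
Lemma halving_cvg (R : realType) (K : numFieldType)
    (hK : real_or_complex R K) (X : completeNormedModType K)
    (u : nat -> X) (a : nat -> K) :
    (forall n, `|u n.+1 - u n| <= a n) -> (forall n, a n.+1 <= a n / 2) ->
  exists l, forall n, `|l - u n| <= 2 * a n.
Proof.
move=> ua a2; have aX := halving_le a2.
have a0 n : 0 <= a n by exact: le_trans (ua n).
have tail n m : `|u (n + m)%N - u n| <= 2 * a n.
  suff : `|u (n + m)%N - u n| <= 2 * a n * (1 - 2^-1 ^+ m).
    by move=> /le_trans; apply; rewrite ler_piMr// mulr_ge0.
  elim: m => [|m IHm]; first by rewrite addn0 !subrr normr0 mulr0.
  rewrite addnS -(subrKA (u (n + m)%N)) (le_trans (ler_normD _ _))//.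
  apply: le_trans (lerD (le_trans (ua _) (aX n m)) IHm) _; rewrite exprS.
  suff -> : a n * 2^-1 ^+ m + 2 * a n * (1 - 2^-1 ^+ m)
    = 2 * a n * (1 - 2^-1 * 2^-1 ^+ m) by [].
  by field.
have tail0 (e : K) : 0 < e -> exists n, 2 * a n < e.
  move=> e0; have a1 : 0 < 2 * a 0%N + 1 by rewrite ltr_wpDl// mulr_ge0.
  have [|n ne] := exists_half_exp_lt hK (e := e / (2 * a 0%N + 1)).
    by rewrite divr_gt0.
  exists n; rewrite ltr_pdivlMr// mulrC in ne; apply: le_lt_trans ne.
  have := aX 0%N n; rewrite add0n => an.
  rewrite (le_trans (ler_wpM2l _ an))// mulrA ler_wpM2r ?lerDl//.
have : cvg (u @ \oo).
  apply: cauchy_cvg; apply: cauchy_exP => e e0.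
  have [n ne] := tail0 e e0; exists (u n), n => // m /= nm.
  by rewrite -ball_normE /= distrC -(subnKC nm) (le_lt_trans (tail _ _)).
move=> /cvg_ex[l ul]; exists l => n; apply/ler_addgt0Pl => e e0.
move/cvgrPdist_lt : ul => /(_ e e0)[N _ Nl].
rewrite -(subrKA (u (n + N)%N)) (le_trans (ler_normD _ _))//.
by rewrite lerD// ltW// Nl//= leq_addl.
Qed.

(** If no A n were dense in a ball, every ball would contain a ball of at most
    half its radius that avoids A n; taking n = 0, 1, 2, ... in turn, the
    centres would converge to a point outside every A n. *)
Lemma Baire_cover (R : realType) (K : numFieldType)
    (hK : real_or_complex R K) (Z : completeNormedModType K)
    (A : nat -> set Z) : (forall z, exists n, A n z) ->
  exists n z0 (r : K), 0 < r /\ forall z, `|z - z0| < r ->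
    forall e, 0 < e -> exists2 w, A n w & `|z - w| < e.
Proof.
move=> Acov; apply: contrapT => noball.
have step (p : nat * (Z * K)) : exists q : Z * K, 0 < p.2.2 ->
    [/\ `|q.1 - p.2.1| <= p.2.2 / 2, 0 < q.2, q.2 <= p.2.2 / 2 &
      forall w, A p.1 w -> ~ `|q.1 - w| <= q.2].
  case: p => n [z0 r] /=; have [r0|] := pselect (0 < r); last by exists (z0, r).
  move/forallNP/(_ n)/forallNP/(_ z0)/forallNP/(_ (r / 2))/not_andP : noball.
  case=> [|/existsNP[z /not_implyP[zz0 /existsNP[e /not_implyP[e0 far]]]]].
    by rewrite divr_gt0.
  have re : 0 < r + e by rewrite addr_gt0.
  (* at most r / 2 and less than e, whether or not r and e are comparable *)
  exists (z, r * e / (2 * (r + e))) => /= _; split.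
  - exact: ltW.
  - by rewrite divr_gt0 ?mulr_gt0.
  - rewrite ler_pdivrMr ?mulr_gt0// [leRHS]mulrA divfK// mulrDr.
    by rewrite lerDr mulr_ge0 ?ltW.
  - move=> w Aw zw; apply: far; exists w => //; apply: le_lt_trans zw _.
    rewrite ltr_pdivrMr ?mulr_gt0// mulrC ltr_pM2l//.
    by rewrite mulrDl mul1r -addrA ltrDl addr_gt0// addr_gt0.
have [f fP] := choice step.
pose fix s n := if n is m.+1 then f (m, s m) else (0, 1).
have s0 n : 0 < (s n).2.
  by elim: n => [|n IHn]; rewrite /= ?ltr01//; case: (fP (n, s n) IHn).
have [||l ls] := @halving_cvg _ _ hK Z
  (fun n => (s n).1) (fun n => (s n).2 / 2).
- by move=> n; case: (fP (n, s n) (s0 n)).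
- by move=> n; rewrite ler_wpM2r ?invr_ge0//; case: (fP (n, s n) (s0 n)).
have [n An] := Acov l; have [_ _ _ /(_ l An)] := fP (n, s n) (s0 n); apply.
by have := ls n.+1; rewrite mulrCA divff// mulr1 distrC.
Qed.

(** Surjectivity plus Baire makes every point approximable to within half its
    norm by the image of a vector of controlled norm; iterating the
    approximation turns it into an exact preimage. *)
Theorem open_mapping (R : realType) (K : numFieldType)
    (hK : real_or_complex R K) (Y Z : completeNormedModType K) (L : Y -> Z) :
    linear L -> (exists M : K, forall y, `|L y| <= M * `|y|) ->
    (forall z, exists y, L y = z) ->
  exists C : K, forall z, exists2 y, L y = z & `|y| <= C * `|z|.
Proof.
move=> linL [M LM] surjL.
pose Ll : {linear Y -> Z} := HB.pack L (GRing.isLinear.Build _ _ _ _ L linL).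
have LD x y : L (x + y) = L x + L y by exact: (linearD Ll).
have LB x y : L (x - y) = L x - L y by exact: (linearB Ll).
have L0 : L 0 = 0 by exact: (linear0 Ll).
have LZ a x : L (a *: x) = a *: L x by rewrite -[a *: x]addr0 linL L0 addr0.
have [|n [z0 [r [r0 near]]]] :=
    @Baire_cover _ _ hK Z (fun n => [set L y | y in [set y | `|y| <= n%:R]]).
  move=> z; have [y yz] := surjL z.
  have [n yn] := exists_natr_gt hK (normr_ge0 y).
  by exists n, y => //; exact: ltW.
have half z : exists y, `|y| <= (4 * n%:R / r) * `|z| /\ `|z - L y| <= `|z| / 2.
  have [->|z_neq0] := eqVneq z 0.
    by exists 0; rewrite L0 subrr !normr0 mulr0 mul0r.
  have nz : 0 < `|z| by rewrite normr_gt0.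
  (* c *: z has norm r / 2, and an error of r / 8 on each of y1, y2 becomes an
     error of `|z| / 2 after division by c *)
  pose c := r / (2 * `|z|); have c0 : 0 < c by rewrite divr_gt0 ?mulr_gt0.
  have e0 : 0 < r / 8 by rewrite divr_gt0.
  have [|_ [y1 /= y1n <-] zy1] := near (z0 + c *: z) _ _ e0.
    rewrite addrC addKr normrZ gtr0_norm// /c invfM mulrA divfK ?gt_eqF//.
    by rewrite ltr_pdivrMr// mulr_natr mulr2n ltrDl.
  have [|_ [y2 /= y2n <-] zy2] := near z0 _ _ e0; first by rewrite subrr normr0.
  exists (c^-1 *: (y1 - y2)); split.
    rewrite normrZ normfV gtr0_norm// /c invf_div mulrC.
    have : `|y1 - y2| <= 2 * n%:R.
      by rewrite (le_trans (ler_normB _ _))// mulrDl mul1r lerD.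
    move=> /(ler_wpM2r (x := 2 * `|z| / r)) /le_trans; apply.
      by rewrite divr_ge0 ?mulr_ge0// ltW.
    suff -> : 2 * n%:R * (2 * `|z| / r) = 4 * n%:R / r * `|z| by [].
    by field; rewrite gt_eqF.
  have -> : z - L (c^-1 *: (y1 - y2)) =
      c^-1 *: ((z0 + c *: z - L y1) - (z0 - L y2)).
    have -> : z0 + c *: z - L y1 - (z0 - L y2) = c *: z - L (y1 - y2).
      by rewrite LB !opprB -[z0 + _ - _]addrA [LHS]addrC addrA subrK addrCA.
    by rewrite [RHS]scalerBr scalerA mulVf ?gt_eqF// scale1r LZ.
  rewrite normrZ normfV gtr0_norm// ler_pdivrMl//.
  rewrite (le_trans (ler_normB _ _))//.
  apply: le_trans (lerD (ltW zy1) (ltW zy2)) _; rewrite /c.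
  suff -> : r / (2 * `|z|) * (`|z| / 2) = r / 8 + r / 8 by [].
  by field; rewrite gt_eqF.
have [g gP] := choice half.
pose C := 4 * n%:R / r.
have C0 : 0 <= C by rewrite divr_ge0 ?mulr_ge0// ltW.
exists (2 * C) => z.
pose s := fix s k := if k is j.+1 then s j - L (g (s j)) else z.
pose y := fix y k := if k is j.+1 then y j + g (s j) else 0.
have ys k : L (y k) = z - s k.
  elim: k => [|k IHk] /=; first by rewrite L0 subrr.
  by rewrite LD IHk opprD opprK addrA.
have s2 k : `|s k.+1| <= `|s k| / 2 by case: (gP (s k)).
have [||l ly] := @halving_cvg _ _ hK Y y (fun k => C * `|s k|).
- by move=> k; rewrite /= addrC addKr; case: (gP (s k)).
- by move=> k; rewrite -[leRHS]mulrA; apply: ler_wpM2l => //; exact: s2.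
exists l; last by have := ly 0%N; rewrite subr0 mulrA.
pose D := `|M| * (2 * C) + 1.
have D0 : 0 <= D by rewrite addr_ge0// mulr_ge0// mulr_ge0.
apply/eqP; rewrite -subr_eq0 -normr_le0.
apply: (le0_half_exp hK (c := D * `|z|)); first by rewrite mulr_ge0.
move=> k; have -> : L l - z = L (l - y k) - s k.
  by rewrite LB ys opprB addrA addrAC addrK.
rewrite (le_trans (ler_normB _ _))//.
have Lk : `|L (l - y k)| <= `|M| * (2 * C) * `|s k|.
  apply: (@le_trans _ _ (`|M| * `|l - y k|)); last first.
    by rewrite -[leRHS]mulrA ler_wpM2l// -[leRHS]mulrA; exact: ly.
  rewrite -[X in _ * X]normr_id -normrM (le_trans (LM _))//.
  by rewrite real_ler_norm// ger0_real// (le_trans _ (LM _)).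
apply: le_trans (lerD Lk (lexx _)) _.
rewrite -[X in _ + X]mul1r -mulrDl -mulrA ler_wpM2l//.
by have := halving_le s2 0 k; rewrite add0n.
Qed.

Section ProdComplete.
Variables (K : numFieldType) (U V : completeNormedModType K).

HB.instance Definition _ :=
  Pointed.copy (U * V)%type ((U * V)%type : pointedType).

Lemma prod_complete (F : set_system (U * V)%type) :
  ProperFilter F -> cauchy F -> cvg F.
Proof.
move=> FF /cauchy_ballP Fc.
have c1 : cauchy (fst @ F).
  apply/cauchy_ballP => e e0; have := Fc _ e0; rewrite !near_simpl.
  move=> [[P Q] /= [FP FQ] PQ]; exists (fst @` P, fst @` Q).
    split; first by apply: filterS FP => x Px; exists x.
    by apply: filterS FQ => x Qx; exists x.
  by move=> [_ _] /= [[x Px <-] [y Qy <-]]; case: (PQ (x, y) (conj Px Qy)).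
have c2 : cauchy (snd @ F).
  apply/cauchy_ballP => e e0; have := Fc _ e0; rewrite !near_simpl.
  move=> [[P Q] /= [FP FQ] PQ]; exists (snd @` P, snd @` Q).
    split; first by apply: filterS FP => x Px; exists x.
    by apply: filterS FQ => x Qx; exists x.
  by move=> [_ _] /= [[x Px <-] [y Qy <-]]; case: (PQ (x, y) (conj Px Qy)).
move: c1 c2 => /cauchy_cvg /cvg_ex[l Fl] /cauchy_cvg /cvg_ex[m Fm].
apply/cvg_ex; exists (l, m); apply/cvg_ballP => e e0.
move/cvg_ballP : Fl => /(_ e e0); move/cvg_ballP : Fm => /(_ e e0).
by rewrite !near_simpl; apply: filterS2 => -[x y].
Qed.
HB.instance Definition _ := Uniform_isComplete.Build (U * V)%type prod_complete.

End ProdComplete.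

(** * Finite-dimensional subspaces *)
Section LinearSets.
Variables (K : fieldType) (V : lmodType K).

Definition linear_set (S : set V) : Prop :=
  S 0 /\ forall a x y, S x -> S y -> S (a *: x + y).

Lemma linear_setD (S : set V) x y : linear_set S -> S x -> S y -> S (x + y).
Proof. by move=> [_ lin] Sx Sy; have := lin 1 _ _ Sx Sy; rewrite scale1r. Qed.

Lemma linear_setZ (S : set V) a x : linear_set S -> S x -> S (a *: x).
Proof. by move=> [S0 lin] Sx; have := lin a _ _ Sx S0; rewrite addr0. Qed.

Lemma linear_setB (S : set V) x y : linear_set S -> S x -> S y -> S (x - y).
Proof.
move=> subS Sx Sy; apply: linear_setD => //.
by rewrite -scaleN1r; exact: linear_setZ.
Qed.

Lemma linear_set_sum (S : set V) n (c : 'I_n -> K) (v : 'I_n -> V) :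
  linear_set S -> (forall i, S (v i)) -> S (\sum_i c i *: v i).
Proof.
move=> subS Sv; apply: (big_ind S); first by case: subS.
- by move=> x y; exact: linear_setD.
- by move=> i _; exact: linear_setZ.
Qed.

Lemma linear_set_lspan n (v : 'I_n -> V) : linear_set (lspan v).
Proof. by split; [exact: lspan0|move=> a x y; exact: lspan_lin]. Qed.

Lemma lspan_mem n (v : 'I_n -> V) i : lspan v (v i).
Proof.
exists (fun j => (j == i)%:R) => //; rewrite (bigD1 i)//= eqxx scale1r.
by rewrite big1 ?addr0// => j /negPf->; rewrite scale0r.
Qed.

Lemma lspan_sub n (v : 'I_n -> V) (S : set V) :
  linear_set S -> (forall i, S (v i)) -> lspan v `<=` S.
Proof. by move=> subS Sv _ [c _ <-]; exact: linear_set_sum. Qed.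

Definition ord_cons T n (x : T) (u : 'I_n -> T) (i : 'I_n.+1) : T :=
  if unlift ord0 i is Some j then u j else x.

Lemma ord_cons0 T n (x : T) (u : 'I_n -> T) : ord_cons x u ord0 = x.
Proof. by rewrite /ord_cons unlift_none. Qed.

Lemma ord_consS T n (x : T) (u : 'I_n -> T) j :
  ord_cons x u (lift ord0 j) = u j.
Proof. by rewrite /ord_cons liftK. Qed.

End LinearSets.

Section Functionals.
Variables (R : realType) (K : numFieldType) (hK : real_or_complex R K).
Variable X : normedModType K.

Definition functional (phi : X -> K) : Prop :=
  scalar phi /\ exists M : K, forall x, `|phi x| <= M * `|x|.

Lemma functional_linear (phi : X -> K) a x y :
  functional phi -> phi (a *: x + y) = a * phi x + phi y.
Proof. by move=> [lin _]; exact: lin. Qed.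

Lemma functional_sum (phi : X -> K) n (c : 'I_n -> K) (v : 'I_n -> X) :
  functional phi -> phi (\sum_i c i *: v i) = \sum_i c i * phi (v i).
Proof.
move=> [lin _].
pose phil : {scalar X} := HB.pack phi (GRing.isLinear.Build _ _ _ _ phi lin).
transitivity (\sum_i phi (c i *: v i)); first exact: (linear_sum phil).
apply: eq_bigr => i _; have phi0 : phi 0 = 0 by exact: (linear0 phil).
by rewrite -[c i *: _]addr0 lin phi0 addr0.
Qed.

(** A bound need not be nonnegative, nor even real; the norm of the bound is
    one that is. *)
Lemma functional_bound (phi : X -> K) : functional phi ->
  exists2 M : K, 0 <= M & forall x, `|phi x| <= M * `|x|.
Proof.
move=> [_ [M phiM]]; exists `|M| => // x.
by rewrite -[X in _ * X]normr_id -normrM (le_trans (phiM x))// real_ler_norm//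
           ger0_real// (le_trans _ (phiM x)).
Qed.

Lemma functional_lin_comb (phi psi : X -> K) a :
  functional phi -> functional psi -> functional (fun x => a * phi x + psi x).
Proof.
move=> fphi fpsi; split.
  by move=> b x y; rewrite !functional_linear//; ring.
have [M M0 phiM] := functional_bound fphi.
have [N N0 psiN] := functional_bound fpsi.
exists (`|a| * M + N) => x; rewrite (le_trans (ler_normD _ _))// mulrDl.
by rewrite lerD// normrM -mulrA ler_wpM2l.
Qed.

Lemma functional0 : functional (fun=> 0).
Proof.
by split=> [a x y|]; [rewrite mulr0 addr0|exists 0 => x; rewrite normr0 mul0r].
Qed.

Lemma functional_lin_sum n (c : 'I_n -> K) (phi : 'I_n -> X -> K) :
  (forall i, functional (phi i)) -> functional (fun x => \sum_i c i * phi i x).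
Proof.
move=> fphi.
elim: n c phi fphi => [|n IHn] c phi fphi.
  by under eq_fun do rewrite big_ord0; exact: functional0.
under eq_fun do rewrite big_ord_recl.
by apply: functional_lin_comb => //; exact: IHn.
Qed.

(** As in the Gram-Schmidt process, a new vector s is first corrected so that
    the functionals already found kill it; a functional psi with psi s = 1 is
    then corrected so that it kills the vectors already found. *)
Lemma biorthogonal (D : set X) : finite_dim D ->
  exists n (v : 'I_n -> X) (phi : 'I_n -> X -> K),
    [/\ D = lspan v, forall i, functional (phi i) &
        forall i j, phi i (v j) = (i == j)%:R].
Proof.
move=> [n [v ->]] {D}; elim: n v => [|n IHn] v.
  by exists 0%N, v, (fun _ _ => 0); split=> // -[].
have [m [u [phi [uE fphi bio]]]] := IHn (fun i => v (lift ord0 i)).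
pose s := v ord0 - \sum_i phi i (v ord0) *: u i.
have phis i : phi i s = 0.
  rewrite /s -scaleN1r addrC functional_linear// functional_sum//.
  rewrite (bigD1 i)//= bio eqxx mulr1 big1 ?addr0 ?mulN1r ?addNr// => j ji.
  by rewrite bio eq_sym (negPf ji) mulr0.
have vE : lspan v = [set x | exists a, lspan u (x - a *: s)].
  have subE : linear_set [set x | exists a, lspan u (x - a *: s)].
    split; first by exists 0; rewrite scale0r subr0; exact: lspan0.
    move=> a x y [b ub] [c uc]; exists (a * b + c).
    rewrite scalerDl opprD addrACA -scalerA -scalerBr.
    by case: (linear_set_lspan u) => _; apply.
  apply/seteqP; split.
    apply: lspan_sub => // i; case: (unliftP ord0 i) => [j|] ->.
      exists 0; rewrite scale0r subr0 -uE.
      exact: (lspan_mem (fun i => v (lift ord0 i))).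
    exists 1; rewrite scale1r /s opprB addrC subrK.
    by apply: linear_set_sum; [exact: linear_set_lspan|exact: lspan_mem].
  have wv : lspan u `<=` lspan v.
    rewrite -uE; apply: lspan_sub; first exact: linear_set_lspan.
    by move=> i; exact: lspan_mem.
  move=> x [a ux]; rewrite -(subrK (a *: s) x); apply: linear_setD => //.
  - exact: linear_set_lspan.
  - exact: wv.
  apply: linear_setZ; first exact: linear_set_lspan.
  apply: linear_setB; [exact: linear_set_lspan|exact: lspan_mem|].
  apply: wv; apply: linear_set_sum; first exact: linear_set_lspan.
  exact: lspan_mem.
have [s0|s0] := eqVneq s 0.
  exists m, u, phi; split=> //; rewrite vE; apply/seteqP; split=> x.
    by move=> [a]; rewrite s0 scaler0 subr0.
  by move=> ux; exists 0; rewrite scale0r subr0.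
have [psi [lpsi bpsi psis]] := norming_functional hK s0.
have fpsi : functional psi by [].
pose chi x := \sum_i - psi (u i) * phi i x + psi x.
have fchi : functional chi.
  have fsum := functional_lin_sum (fun i => - psi (u i)) fphi.
  have := functional_lin_comb 1 fsum fpsi.
  by under eq_fun do rewrite mul1r.
exists m.+1, (ord_cons s u), (ord_cons chi phi); split.
- rewrite vE; apply/seteqP; split=> x.
    move=> [a [c _ cx]]; exists (ord_cons a c) => //.
    rewrite big_ord_recl !ord_cons0; under eq_bigr do rewrite !ord_consS.
    by rewrite cx addrC subrK.
  move=> [c _ <-]; exists (c ord0); rewrite big_ord_recl ord_cons0 addrC addKr.
  exists (fun i => c (lift ord0 i)) => //.
  by apply: eq_bigr => i _; rewrite ord_consS.
- by move=> i; case: (unliftP ord0 i) => [j|] ->; rewrite ?ord_consS ?ord_cons0.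
- move=> i j; case: (unliftP ord0 i) => [i'|] ->;
    case: (unliftP ord0 j) => [j'|] ->;
    rewrite ?ord_consS ?ord_cons0.
  + by rewrite bio (inj_eq lift_inj).
  + by rewrite phis eq_sym (negPf (neq_lift _ _)).
  + rewrite (negPf (neq_lift _ _)) /chi (bigD1 j')//= bio eqxx mulr1 big1.
      by rewrite addr0 addNr.
    by move=> k kj; rewrite bio (negPf kj) mulr0.
  + by rewrite eqxx /chi big1 ?add0r// => k _; rewrite phis mulr0.
Qed.

End Functionals.

(** * Finite-rank operators and generalised inverses *)

(** Von Neumann's lemma: a generalised inverse up to a regular error can be
    corrected to an exact one. *)
Lemma quasi_regular (A : pzRingType) (a b g : A) :
  (a - a * b * a) * g * (a - a * b * a) = a - a * b * a ->
  exists s, a * s * a = a.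
Proof.
move=> rgr; exists (b + (1 - b * a) * g * (1 - a * b)).
have -> : a * (b + (1 - b * a) * g * (1 - a * b)) * a =
    a * b * a + a * (1 - b * a) * g * ((1 - a * b) * a).
  by rewrite mulrDr mulrDl !mulrA.
by rewrite mulrBl mul1r [a * (1 - _)]mulrBr mulr1 mulrA rgr addrC subrK.
Qed.

Section Evaluation.
Variables (K : numFieldType) (X : normedModType K).
Implicit Types f g : 'L(X).

Lemma bopM f g x : (f * g) x = f (g x). Proof. by []. Qed.
Lemma bopD f g x : (f + g) x = f x + g x. Proof. by []. Qed.
Lemma bopN f x : (- f) x = - f x. Proof. by []. Qed.
Lemma bop1 x : (1 : 'L(X)) x = x. Proof. by []. Qed.
Lemma bop0 x : (0 : 'L(X)) x = 0. Proof. by []. Qed.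

Lemma bopDr f x y : f (x + y) = f x + f y. Proof. exact: linearD. Qed.
Lemma bopBr f x y : f (x - y) = f x - f y. Proof. exact: linearB. Qed.
Lemma bopZr f a x : f (a *: x) = a *: f x. Proof. exact: linearZ. Qed.
Lemma bopr0 f : f 0 = 0. Proof. exact: linear0. Qed.

Definition bopE := (bopM, bopD, bopN, bop1, bop0).

Lemma closed_ker f : closed [set x | f x = 0].
Proof.
apply: (@closed_comp _ _ f [set 0]) => [x _|]; first exact: bop_continuous.
exact: (accessible_closed_set1 (hausdorff_accessible (@norm_hausdorff _ _))).
Qed.

Lemma frquot_pi_eq0 f : frquot_pi f = 0 <-> f \in finite_rank (X := X).
Proof. by rewrite -(raddf0 (@frquot_pi K X)) frquot_piP subr0. Qed.

End Evaluation.

Section FiniteRank.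
Variables (R : realType) (K : numFieldType) (hK : real_or_complex R K).
Variable X : normedModType K.
Implicit Types f g U : 'L(X).

Lemma sum_functionals_op n (phi : 'I_n -> X -> K) (u : 'I_n -> X) :
  (forall i, functional (phi i)) ->
  exists2 q : 'L(X), q \in finite_rank (X := X) &
    forall x, q x = \sum_i phi i x *: u i.
Proof.
move=> fphi; pose q x := \sum_i phi i x *: u i.
have linq : linear q.
  move=> a x y; rewrite /q scaler_sumr -big_split; apply: eq_bigr => i _ /=.
  by rewrite functional_linear// scalerDl scalerA.
have bq : bounded_op q.
  have /choice[M phiM] i : exists M : K, forall x, `|phi i x| <= M * `|x|.
    by case: (fphi i).
  exists (\sum_i M i * `|u i|) => x; rewrite mulr_suml.
  rewrite (le_trans (ler_norm_sum _ _ _))// ler_sum// => i _.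
  by rewrite normrZ mulrAC ler_wpM2r.
exists (Bop linq bq) => //; apply/finite_rankP; exists n, u => _ [x _ <-].
by exists (fun i => phi i x).
Qed.

Lemma finite_dim_projection (D : set X) : finite_dim D ->
  exists2 q : 'L(X), q \in finite_rank (X := X) &
    (forall x, D (q x)) /\ forall x, D x -> q x = x.
Proof.
move=> /(biorthogonal hK)[n [v [phi [-> fphi bio]]]].
have [q q_fr qE] := sum_functionals_op v fphi; exists q => //; split=> [x|].
  by rewrite qE; exists (fun i => phi i x).
move=> _ [c _ <-]; rewrite qE; apply: eq_bigr => i _.
rewrite functional_sum// (bigD1 i)//= bio eqxx mulr1 big1 ?addr0// => j ji.
by rewrite bio eq_sym (negPf ji) mulr0.
Qed.

(** Only the finitely many vectors of a basis of range f need a preimage, and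
    the coordinates of f are bounded functionals; so a pointwise lift of f
    through U yields a bounded linear one. *)
Lemma finite_rank_lift f U (V : set X) : linear_set V ->
    f \in finite_rank (X := X) -> (forall x, exists2 y, V y & U y = f x) ->
  exists2 w : 'L(X), w \in finite_rank (X := X) &
    U * w = f /\ forall x, V (w x).
Proof.
move=> linV /asboolP/(biorthogonal hK)[n [v [phi [fE fphi bio]]]] fU.
have /choice[y yP] i : exists y, V y /\ U y = v i.
  have [x _ xv] : range f (v i) by rewrite fE; exact: lspan_mem.
  by have [y Vy Uy] := fU x; exists y; split; rewrite // Uy xv.
have [w w_fr wE] := sum_functionals_op y fphi.
exists (w * f); first exact: finite_rankMr.
split=> [|x]; last first.
  by rewrite bopM wE; apply: linear_set_sum => // i; case: (yP i).
apply: bopP => x; rewrite !bopM wE linear_sum.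
have [c _ <-] : lspan v (f x) by rewrite -fE; exists x.
apply: eq_bigr => i _; rewrite linearZ /=; case: (yP i) => _ ->.
rewrite functional_sum// (bigD1 i)//= bio eqxx mulr1 big1 ?addr0// => j ji.
by rewrite bio eq_sym (negPf ji) mulr0.
Qed.

(** The generalised inverse is a lift, through f itself, of a projection onto
    range f. *)
Lemma finite_rank_regular f : f \in finite_rank (X := X) ->
  exists g, f * g * f = f.
Proof.
move=> f_fr; have [q q_fr [qf fq]] := finite_dim_projection (asboolP _ f_fr).
have linT : linear_set [set: X] by [].
have [|g _ [gE _]] := finite_rank_lift (U := f) linT q_fr.
  by move=> x; have [y _ yq] := qf x; exists y.
by exists g; apply: bopP => x; rewrite gE bopM fq//; exists x.
Qed.

Lemma regular_modulo_finite_rank U b : U * b * U - U \in finite_rank (X := X) ->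
  exists s, U * s * U = U.
Proof.
rewrite -rpredN opprB => /finite_rank_regular[g]; exact: quasi_regular.
Qed.

End FiniteRank.

(** U b - 1 has finite rank, so U has a generalised inverse s, and both U s and
    s U are idempotent: range U is the kernel of 1 - U s, hence closed, and
    ker U is the range of 1 - s U, hence complemented. *)
Lemma right_semi_Fredholm_of_right_inverse (R : realType) (K : numFieldType)
    (hK : real_or_complex R K) (Y : completeNormedModType K) (U b : 'L(Y)) :
  U * b - 1 \in finite_rank (X := Y) -> right_semi_Fredholm U.
Proof.
move=> Ub; have [s sE] : exists s, U * s * U = U.
  apply: (regular_modulo_finite_rank hK (b := b)).
  have -> : U * b * U - U = (U * b - 1) * U by rewrite mulrBl mul1r.
  exact: finite_rankMr.
have UsU x : U (s (U x)) = U x by rewrite -[in RHS]sE.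
split.
- have -> : range U = [set x | (1 - U * s) x = 0].
    apply/seteqP; split=> [_ [x _ <-]|y] /=; first by rewrite UsU subrr.
    by move=> /eqP; rewrite subr_eq0 => /eqP ->; exists (s y).
  exact: closed_ker.
- have /finite_rankP[n [v UbE]] := Ub.
  exists n, v => y; exists (U (b y)); first by exists (b y).
  rewrite -opprB -scaleN1r; apply: linear_setZ; first exact: linear_set_lspan.
  by apply: UbE; exists y.
- exists (1 - s * U).
    apply: bopP => x; rewrite !bopE [U (_ - _)]linearB /= UsU subrr.
    by rewrite linear0 subr0.
  apply/seteqP; split=> [_ [x _ <-]|x Ux].
    by rewrite /ker_op /= linearB /= UsU subrr.
  by exists x => //; rewrite !bopE Ux linear0 subr0.
Qed.

(** * Complements and right inverses from the open mapping theorem *)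
Section ClosedSubspaces.
Variables (R : realType) (K : numFieldType) (hK : real_or_complex R K).
Variable X : completeNormedModType K.

Lemma closed_linear_set (S : set X) : linear_set S -> closed S ->
  exists W : closed_subspace X, forall x, (x \in csub_pred W) = (x \in S).
Proof.
move=> [S0 Slin] Scl; pose P : {pred X} := fun x => x \in S.
have Pcl : GRing.submod_closed P.
  split=> [|a x y]; first exact: mem_set.
  by move=> /set_mem Sx /set_mem Sy; apply: mem_set; exact: Slin.
pose Q : submodClosed X :=
  HB.pack P (GRing.isSubmodClosed.Build K X P Pcl).
have Qcl : closed [set x : X | x \in Q].
  rewrite (_ : [set x | x \in Q] = S)//.
  by apply/seteqP; split=> x; [exact: set_mem|exact: mem_set].
by exists (ClosedSubspace Qcl).
Qed.

Lemma norm_prod_fst (U V : normedModType K) (u : U) (v : V) :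
  `|u| <= `|(u, v)| :> K.
Proof.
rewrite -[leRHS]/(Num.max `|u| `|v|).
by have [] := real_leP (normr_real u) (normr_real v).
Qed.

Lemma norm_prod_snd (U V : normedModType K) (u : U) (v : V) :
  `|v| <= `|(u, v)| :> K.
Proof.
rewrite -[leRHS]/(Num.max `|u| `|v|).
by have [|/ltW] := real_leP (normr_real u) (normr_real v).
Qed.

Lemma linear_set_csub (M : closed_subspace X) :
  linear_set [set x | x \in csub_pred M].
Proof.
by split=> [|a x y] /=; [exact: rpred0|move=> Mx My; rewrite rpredD// rpredZ].
Qed.

(** Addition maps the Banach space M * N onto X, so by the open mapping theorem
    the components of x are bounded in terms of x. *)
Lemma direct_sum_projection (M N : closed_subspace X) : direct_sum M N ->
  exists E : 'L(X), [/\ forall x, E x \in csub_pred M,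
    forall x, x - E x \in csub_pred N,
    forall x, x \in csub_pred M -> E x = x &
    forall x, x \in csub_pred N -> E x = 0].
Proof.
move=> [MN MN0].
pose L (u : (csub M * csub N)%type) : X := val u.1 + val u.2.
have linL : linear L.
  by move=> a [m n] [m' n']; rewrite /L scalerDr addrACA.
have [||C LC] := open_mapping hK linL.
- exists 2 => -[m n]; rewrite (le_trans (ler_normD _ _))// mulrDl mul1r.
  by rewrite lerD// ?norm_prod_fst ?norm_prod_snd.
- move=> x; have [m Mm [n Nn ->]] := MN x.
  by exists (Csub Mm, Csub Nn).
have unique m n m' n' : m \in csub_pred M -> n \in csub_pred N ->
    m' \in csub_pred M -> n' \in csub_pred N -> m + n = m' + n' -> m = m'.
  move=> Mm Nn Mm' Nn' mn; apply/eqP; rewrite -subr_eq0; apply/eqP.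
  apply: MN0; first exact: (linear_setB (linear_set_csub M)).
  suff -> : m - m' = n' - n by exact: (linear_setB (linear_set_csub N)).
  by rewrite -[m in LHS](addrK n) mn -[_ - n]addrA [LHS]addrC addKr.
have /choice[u uP] x : exists u, L u = x /\ `|u| <= C * `|x|.
  by have [u ? ?] := LC x; exists u.
pose e x := val (u x).1.
have eM x : e x \in csub_pred M by exact: csub_valP.
have eN x : x - e x \in csub_pred N.
  rewrite -{1}(uP x).1 /L addrC addKr; exact: csub_valP.
have e_eq x m : m \in csub_pred M -> x - m \in csub_pred N -> e x = m.
  move=> Mm Nxm; apply: (unique _ (x - e x) _ (x - m)) => //.
  by rewrite !(addrC _ (x - _)) !subrK.
have line : linear e.
  move=> a x y; apply: e_eq; first by rewrite rpredD// rpredZ.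
  by rewrite opprD addrACA -scalerBr rpredD// rpredZ.
have bounde : bounded_op e.
  exists C => x; apply: le_trans (uP x).2.
  by rewrite (surjective_pairing (u x)); exact: norm_prod_fst.
exists (Bop line bounde); split=> //= x.
  by move=> Mx; apply: e_eq => //; rewrite subrr rpred0.
by move=> Nx; apply: e_eq; rewrite ?rpred0 ?subr0.
Qed.

End ClosedSubspaces.

(** A bounded projection Q onto range U exists because range U is closed and has
    a finite-dimensional, hence closed, complement; the open mapping theorem
    bounds some preimage y of Q x, and subtracting its component P y in ker U
    makes the choice linear in x. *)
Lemma right_inverse_of_right_semi_Fredholm (R : realType) (K : numFieldType)
    (hK : real_or_complex R K) (Y : completeNormedModType K) (U : 'L(Y)) :
  right_semi_Fredholm U -> exists b, U * b - 1 \in finite_rank (X := Y).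
Proof.
move=> [Ucl [n [v Uv]] [P PP PK]].
have linU : linear_set (range U).
  split=> [|a _ _ [x _ <-] [y _ <-]]; first by exists 0; rewrite ?linear0.
  by exists (a *: x + y); rewrite ?linearP.
have linv := linear_set_lspan v.
have [q q_fr [qD Dq]] : exists2 q : 'L(Y), q \in finite_rank (X := Y) &
    (forall x, (range U `&` lspan v) (q x)) /\
    forall x, (range U `&` lspan v) x -> q x = x.
  apply: (finite_dim_projection hK).
  apply: (finite_dim_sub _ _ (@subIsetr _ _ _)).
    by split; [case: linU|case: linv].
  by move=> a x y [Ux vx] [Uy vy]; split; [apply: linU.2|apply: linv.2].
(* removing from lspan v what it shares with range U leaves a complement *)
pose D := lspan v `&` [set x | q x = 0].
have linD : linear_set D.
  split; first by split; [case: linv|rewrite /= linear0].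
  move=> a x y [vx /= qx] [vy /= qy]; split; first exact: linv.2.
  by rewrite /= linearP /= qx qy scaler0 addr0.
have [p p_fr [pD Dp]] := finite_dim_projection hK
  (finite_dim_sub linD.1 linD.2 (@subIsetl _ _ _)).
have Dcl : closed D.
  have -> : D = [set x | (1 - p) x = 0].
    apply/seteqP; split=> x /=; first by move=> /Dp ->; rewrite subrr.
    by move=> /eqP; rewrite subr_eq0 => /eqP ->.
  exact: closed_ker.
have [W WE] := closed_linear_set linU Ucl.
have [N NE] := closed_linear_set linD Dcl.
have WN : direct_sum W N.
  split=> [x|x]; last first.
    rewrite WE NE => /set_mem Ux /set_mem [vx /= qx].
    by rewrite -(Dq x).
  have [s Us vs] := Uv x.
  have [Uq vq] := qD (x - s).
  exists (s + q (x - s)).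
    by rewrite WE; apply: mem_set; exact: linear_setD.
  exists (x - s - q (x - s)); last by rewrite addrACA subrr addr0 addrC subrK.
  rewrite NE; apply: mem_set; split; first exact: linear_setB.
  by rewrite /= linearB /= (Dq (q _)) ?subrr.
have [Q [QW QN QidW QN0]] := direct_sum_projection hK WN.
have UW x : U x \in csub_pred W by rewrite WE; apply: mem_set; exists x.
pose L x : csub W := Csub (UW x).
have linL : linear L.
  by move=> a x y; apply: val_inj; rewrite /= linearP.
have [||C LC] := open_mapping hK linL.
- by have [M UM] := bop_bounded U; exists M => x; exact: UM.
- move=> [w Ww]; have := Ww; rewrite WE => /set_mem [x _ xw].
  by exists x; apply: val_inj.
have /choice[y yP] x : exists y, U y = Q x /\ `|y| <= C * `|Q x|.
  have [y Ly yC] := LC (Csub (QW x)); exists y; split=> //.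
  by rewrite -[LHS]/(val (L y)) Ly.
have UP x : U (P x) = 0 by have : range P (P x) by []; rewrite PK.
have PU x : U x = 0 -> P x = x.
  move=> Ux; have : ker_op U x by []. 
  by rewrite -PK => -[z _ <-]; rewrite -[LHS]/((P * P) z) PP.
pose b x := y x - P (y x).
have b_eq x z : U z = Q x -> b x = z - P z.
  move=> Uz; have : P (z - y x) = z - y x.
    by apply: PU; rewrite linearB /= Uz (yP x).1 subrr.
  rewrite linearB /= => Pzy.
  by rewrite -{1}[z](subrK (y x)) -Pzy -[RHS]addrA [RHS]addrC subrKA.
have linb : linear b.
  move=> a x x'; rewrite (b_eq _ (a *: y x + y x')).
    by rewrite linearP /= /b opprD addrACA scalerBr.
  by rewrite !linearP /= (yP x).1 (yP x').1.
have boundb : bounded_op b.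
  have [MQ _ QM] := bop_bound Q; have [MP MP0 PM] := bop_bound (1 - P).
  exists (MP * (`|C| * MQ)) => x.
  rewrite (le_trans (PM (y x)))// -mulrA ler_wpM2l// (le_trans (yP x).2)//.
  apply: (@le_trans _ _ (`|C| * `|Q x|)); last by rewrite -mulrA ler_wpM2l.
  rewrite -[X in _ <= _ * X]normr_id -normrM real_ler_norm//.
  by rewrite ger0_real// (le_trans _ (yP x).2).
exists (Bop linb boundb); apply/finite_rankP; exists n, v => _ [x _ <-].
have -> : (U * Bop linb boundb - 1) x = (-1) *: (x - Q x).
  by rewrite !bopE /= /b linearB /= UP subr0 (yP x).1 scaleN1r opprB.
apply: linear_setZ => //.
by have := QN x; rewrite NE => /set_mem [].
Qed.

(** * Idempotents modulo finite rank *)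
Section Idempotents.
Variables (R : realType) (K : numFieldType) (hK : real_or_complex R K).
Variable X : completeNormedModType K.
Implicit Types f g E P S T : 'L(X).
Notation pi := (@frquot_pi K X).

(** For a preimage P of p, f = P P - P has finite rank and commutes with P, so
    ker f is P-invariant, and P is idempotent there.  Composing P with a
    projection r onto ker f, which differs from the identity by finite rank,
    gives the lift. *)
Lemma idempotent_lift (p : frquot X) : p * p = p ->
  exists E : 'L(X), E * E = E /\ pi E = p.
Proof.
have [P ->] := frquot_pi_surj p; rewrite -rmorphM => /frquot_piP.
set f := P * P - P => f_fr; have [g fgf] := finite_rank_regular hK f_fr.
have f0 : pi f = 0 by exact/frquot_pi_eq0.
pose r : 'L(X) := 1 - g * f.
have fr0 : f * r = 0 by rewrite mulrBr mulr1 mulrA fgf subrr.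
have Pf : f * P = P * f by rewrite /f mulrBl mulrBr mulrA.
have rPr : r * (P * r) = P * r.
  by rewrite [LHS]mulrBl mul1r -mulrA [f * _]mulrA Pf -mulrA fr0 !mulr0 subr0.
have PP : P * P = P + f by rewrite addrC subrK.
exists (P * r); split.
  by rewrite -mulrA rPr mulrA PP mulrDl fr0 addr0.
by rewrite rmorphM rmorphB rmorphM /= f0 mulr0 subr0 rmorph1 mulr1.
Qed.

Lemma idempotent_fixed E x : E * E = E -> E (E x) = E x.
Proof. by move=> EE; rewrite -[E (E x)]/((E * E) x) EE. Qed.

(** A complement of ker f within range E is the range of the idempotent h, which
    comes from a generalised inverse of f E. *)
Lemma idempotent_carve E f : E * E = E -> f \in finite_rank (X := X) ->
  exists E', [/\ E' * E' = E', pi E' = pi E &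
    forall x, E' x = x <-> E x = x /\ f x = 0].
Proof.
move=> EE f_fr; have fE_fr := finite_rankMr E f_fr.
have [g gE] := finite_rank_regular hK fE_fr.
pose h := E * g * (f * E).
have hh : h * h = h.
  have -> : h * h = E * g * (f * E * E * g * (f * E)) by rewrite /h !mulrA.
  by rewrite -(mulrA f) EE gE.
have Eh : E * h = h by rewrite /h !mulrA EE.
have hE : h * E = h by rewrite /h -!mulrA EE.
exists (E - h); split.
- by rewrite mulrBr !mulrBl EE hE Eh hh subrr subr0.
- rewrite rmorphB /=; have -> : pi h = 0; last by rewrite subr0.
  by apply/frquot_pi_eq0; exact: finite_rankMl.
move=> x; split=> [Ehx|[Ex fx]]; last first.
  by rewrite bopD bopN -[h x]/((E * g) (f (E x))) Ex fx linear0 subr0.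
have Ex : E x = x.
  by rewrite -Ehx -bopM mulrBr EE Eh.
split=> //; rewrite -Ehx -bopM.
have -> : f * (E - h) = 0; last by [].
have -> : f * (E - h) = f * E - f * E * g * (f * E) by rewrite mulrBr /h !mulrA.
by rewrite gE subrr.
Qed.

Lemma idempotent_carve_family E (f : nat -> 'L(X)) n : E * E = E ->
    (forall i, f i \in finite_rank (X := X)) ->
  exists E', [/\ E' * E' = E', pi E' = pi E &
    forall x, E' x = x <-> E x = x /\ forall i, (i < n)%N -> f i x = 0].
Proof.
move=> EE f_fr; elim: n => [|n [E1 [E1E piE1 fixE1]]].
  by exists E; split=> // x; split=> [|[]].
have [E' [E'E piE' fixE']] := idempotent_carve E1E (f_fr n).
exists E'; split=> //; first by rewrite piE'.
move=> x; rewrite fixE' fixE1; split=> [[[Ex fx] fnx]|[Ex fx]].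
  by split=> // i; rewrite ltnS leq_eqVlt => /orP[/eqP->//|]; exact: fx.
by split; [split=> // i ni; apply: fx; exact: ltnW|exact: fx].
Qed.

Lemma idempotent_adjoin E v : E * E = E ->
  exists E', [/\ E' * E' = E', pi E' = pi E &
    forall x, E' x = x <-> exists c, E (x - c *: v) = x - c *: v].
Proof.
move=> EE; have [Ev|/eqP] := eqVneq (v - E v) 0.
  exists E; split=> // x; split=> [Ex|[c]].
    by exists 0; rewrite scale0r subr0.
  have Evv : E v = v by apply/eqP; rewrite eq_sym -subr_eq0 Ev.
  by rewrite linearB linearZ /= Evv => /addIr.
set w := v - E v => /eqP w0.
have [phi [lphi bphi phiw]] := norming_functional hK w0.
have fphi (i : 'I_1) : functional phi by [].
have [q q_fr qE] := sum_functionals_op (fun=> w) fphi.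
have {}qE x : q x = phi x *: w by rewrite qE big_ord_recl big_ord0 addr0.
have Ew : E w = 0 by rewrite /w linearB /= idempotent_fixed// subrr.
have phi0 : phi 0 = 0.
  by rewrite -(subrr w) -scaleN1r addrC lphi phiw mulr1 addNr.
pose E' := E + q * (1 - E).
have E'E x : E' x = E x + phi (x - E x) *: w by rewrite !bopE qE.
exists E'; split.
- apply: bopP => x; rewrite bopM [in LHS]E'E.
  have EE' : E (E' x) = E x.
    by rewrite E'E linearD linearZ /= Ew scaler0 addr0 idempotent_fixed.
  have -> : E' x - E (E' x) = phi (x - E x) *: w by rewrite EE' E'E addrC addKr.
  rewrite EE' E'E -[in X in phi X](addr0 (_ *: w)) lphi phiw phi0.
  by rewrite addr0 mulr1.
- rewrite rmorphD rmorphM /=.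
  by rewrite (_ : pi q = 0) ?mul0r ?addr0//; exact/frquot_pi_eq0.
move=> x; rewrite E'E; split=> [Ex|[c]].
  exists (phi (x - E x)); set c := phi _ in Ex *.
  have {}Ex : E x = x - c *: w by rewrite -{2}Ex addrK.
  rewrite linearB linearZ /= Ex /w scalerBr opprB -addrA.
  by rewrite [_ - _ - _]addrAC subrr add0r.
rewrite linearB linearZ /= => Exc.
have Exw : x - E x = c *: w.
  rewrite scalerBr -{1}[x](subrK (c *: v)) -Exc.
  by rewrite addrC -addrA addKr addrC.
rewrite Exw -[in X in phi X](addr0 (_ *: w)) lphi phiw phi0 addr0 mulr1 -Exw.
by rewrite addrC subrK.
Qed.

End Idempotents.

(** * Invariant subspaces on which T is nilpotent *)
Section Codimension.
Variables (K : fieldType) (V : lmodType K).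

Definition codim_le (n : nat) (S : set V) : Prop :=
  exists v : 'I_n -> V, forall y, exists2 s, S s & lspan v (y - s).

Lemma codim_le_decrease n (S S' : set V) x :
    linear_set S -> linear_set S' -> S `<=` S' -> S' x -> ~ S x ->
  codim_le n S -> exists2 m, (m < n)%N & codim_le m S'.
Proof.
case: n => [|n] linS linS' SS' S'x nSx [v Sv].
  have [s Ss [c _]] := Sv x; rewrite big_ord0 => /esym/eqP.
  by rewrite subr_eq0 => /eqP xs; case: nSx; rewrite xs.
exists n => //; have [s Ss [c _ cE]] := Sv x.
have [i0 ci0] : exists i, c i != 0.
  apply: contrapT => /forallNP c0; apply: nSx; suff -> : x = s by [].
  apply/eqP; rewrite -subr_eq0 -cE big1// => i _.
  by have /negP/negPn/eqP -> := c0 i; rewrite scale0r.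
rewrite (bigD1_ord i0)//= in cE.
exists (fun i => v (lift i0 i)) => y; have [t St [d _ dE]] := Sv y.
rewrite (bigD1_ord i0)//= in dE.
pose a := d i0 / c i0.
exists (t + a *: (x - s)).
  apply: linear_setD => //; first exact: SS'.
  by apply: linear_setZ => //; apply: linear_setB => //; exact: SS'.
rewrite opprD addrA -dE -cE scalerDr scalerA divfK//.
rewrite opprD addrACA subrr add0r -scaleN1r scalerA.
exists (fun i => d (lift i0 i) - a * c (lift i0 i)) => //.
rewrite scaler_sumr -big_split; apply: eq_bigr => i _ /=.
by rewrite scalerBl scalerA mulN1r mulNr scaleNr.
Qed.

End Codimension.

Section NilpotentProjections.
Variables (R : realType) (K : numFieldType) (hK : real_or_complex R K).
Variable X : completeNormedModType K.
Variable T : 'L(X).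
Implicit Types f g E P S : 'L(X).
Notation pi := (@frquot_pi K X).

(** The second condition says that range E is T-invariant: T is block triangular
    for range E and ker E, and the third condition makes the block on range E
    nilpotent. *)
Definition nilpotent_projection E : Prop :=
  [/\ E * E = E, E * T * E = T * E & exists n, T ^+ n * E = 0].

Lemma nilpotent_projectionP E : E * E = E ->
  nilpotent_projection E <->
  (forall x, E x = x -> E (T x) = T x) /\
  exists n, forall x, E x = x -> (T ^+ n) x = 0.
Proof.
move=> EE; split=> [[_ ETE [n TnE]]|[Einv [n Tn0]]].
  split=> [x Ex|]; first by rewrite -Ex -[RHS]/((T * E) x) -ETE.
  by exists n => x Ex; rewrite -Ex -[LHS]/((T ^+ n * E) x) TnE.
split=> //; last first.
  by exists n; apply: bopP => x; rewrite bopM Tn0// idempotent_fixed.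
by apply: bopP => x; rewrite !bopM Einv// idempotent_fixed.
Qed.

(** For a lift E0 of p, the operators (1 - E0) T^i E0 and T^n E0 have finite
    rank; their common kernel in range E0 is the largest T-invariant subspace of
    range E0 on which T^n = 0, and has finite codimension in range E0.  The
    exponent is positive so that T maps this subspace into range E0. *)
Lemma nilpotent_projection_lift (p : frquot X) n :
    p * p = p -> GRing.comm (pi T) p -> (pi T * p) ^+ n.+1 = 0 ->
  exists2 E, nilpotent_projection E & pi E = p.
Proof.
move=> pp Tp; move: n.+1 (ltn0Sn n) => {}n n0 Tpn.
have [E0 [E0E piE0]] := idempotent_lift hK pp.
have pn : p ^+ n * p = p.
  by elim: n {n0 Tpn} => [|k IHk]; rewrite ?expr0 ?mul1r// exprS -mulrA IHk.
have TnE_fr : T ^+ n * E0 \in finite_rank (X := X).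
  apply/frquot_pi_eq0; rewrite rmorphM rmorphXn /= piE0 -pn mulrA.
  by rewrite -exprMn_comm// Tpn mul0r.
have offdiag_fr i : (1 - E0) * T ^+ i * E0 \in finite_rank (X := X).
  apply/frquot_pi_eq0; rewrite !rmorphM rmorphB rmorph1 rmorphXn /= piE0.
  rewrite -mulrA -(commrX i (commr_sym Tp)) mulrA mulrBl mul1r pp.
  by rewrite subrr mul0r.
pose f i := if i == n then T ^+ n * E0 else (1 - E0) * T ^+ i * E0.
have [|E [EE piE fixE]] := idempotent_carve_family hK (f := f) n.+1 E0E.
  by move=> i; rewrite /f; case: eqP.
exists E; last by rewrite piE.
apply/nilpotent_projectionP => //.
have fix_pow x : E x = x <->
    (forall i, (i < n)%N -> E0 ((T ^+ i) x) = (T ^+ i) x) /\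
    E0 x = x /\ (T ^+ n) x = 0.
  rewrite fixE; split=> [[E0x fx]|[E0T [E0x Tnx]]].
    split=> [i ni|].
      have := fx i (ltnW ni); rewrite /f (ltn_eqF ni) !bopM !bopE E0x.
      by move/eqP; rewrite subr_eq0 => /eqP.
    by split=> //; have := fx n (ltnSn n); rewrite /f eqxx bopM E0x.
  split=> // i; rewrite ltnS leq_eqVlt /f => /orP[/eqP ->|ni].
    by rewrite eqxx bopM E0x.
  by rewrite (ltn_eqF ni) !bopM !bopE E0x E0T// subrr.
split=> [x|]; last by exists n => x /fix_pow[_ []].
move=> /fix_pow[E0T [E0x Tnx]]; apply/fix_pow.
have TnT : (T ^+ n) (T x) = 0.
  by rewrite -bopM -exprSr exprS bopM Tnx linear0.
have Ti i : (T ^+ i) (T x) = (T ^+ i.+1) x by rewrite exprSr.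
split=> [i ni|].
  rewrite Ti; have [/E0T//|] := ltnP i.+1 n.
  by rewrite leq_eqVlt ltnS leqNgt ni orbF => /eqP <-; rewrite Tnx linear0.
split=> //; have [n1|] := ltnP 1 n; first by have := E0T _ n1; rewrite expr1.
rewrite leq_eqVlt ltnS leqNgt n0 orbF => /eqP n1.
by rewrite n1 expr1 in Tnx *; rewrite Tnx linear0.
Qed.

Lemma nilpotent_projection_adjoin E y : nilpotent_projection E ->
    E (T y) = T y ->
  exists E', [/\ nilpotent_projection E', pi E' = pi E,
    forall x, E x = x -> E' x = x & E' y = y].
Proof.
move=> nilE ETy; have [EE _ _] := nilE.
have [Einv [n Tn0]] := (nilpotent_projectionP EE).1 nilE.
have [E' [E'E piE' fixE']] := idempotent_adjoin hK y EE.
have EE' x : E x = x -> E' x = x.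
  by move=> Ex; apply/fixE'; exists 0; rewrite scale0r subr0.
exists E'; split=> //; last first.
  by apply/fixE'; exists 1; rewrite scale1r subrr linear0.
have fixT x : E' x = x -> E (T x) = T x.
  move=> /fixE'[c] Exy.
  have -> : T x = T (x - c *: y) + c *: T y by rewrite linearB linearZ /= subrK.
  by rewrite bopDr Einv// bopZr ETy.
apply/nilpotent_projectionP => //; split=> [x /fixT/EE'//|].
by exists n.+1 => x /fixT ETx; rewrite exprSr bopM Tn0.
Qed.

(** The orbit of x is adjoined one vector at a time, starting from its last
    vector outside range E. *)
Lemma nilpotent_projection_absorb E j x : nilpotent_projection E ->
    E ((T ^+ j) x) = (T ^+ j) x ->
  exists E', [/\ nilpotent_projection E', pi E' = pi E,
    forall y, E y = y -> E' y = y & E' x = x].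
Proof.
move=> nilE; elim: j x => [|j IHj] x; first by exists E.
rewrite exprSr bopM => /IHj[E1 [nilE1 piE1 EE1 E1Tx]].
have [E2 [nilE2 piE2 E12 E2x]] := nilpotent_projection_adjoin nilE1 E1Tx.
by exists E2; split=> //; [rewrite piE2|move=> y /EE1/E12].
Qed.

(** A vector killed by a power of T that lies outside range T + range E can be
    absorbed in range E together with its orbit; this lowers the codimension of
    range T + range E, so it can happen only finitely often. *)
Lemma nilpotent_projection_saturate E : nilpotent_projection E ->
    (exists n, codim_le n [set y | exists u m, E m = m /\ y = T u + m]) ->
  exists E', [/\ nilpotent_projection E', pi E' = pi E &
    forall j x, (T ^+ j) x = 0 -> exists u m, E' m = m /\ x = T u + m].
Proof.
move=> nilE [n]; have [k kn] := ubnP n; elim: k n kn E nilE => // k IHk n.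
rewrite ltnS => nk E nilE codE.
pose sum P := [set y | exists u m, P m = m /\ y = T u + m].
have [//|/existsNP[j /existsNP[x /not_implyP[Tjx nsum]]]] :=
  pselect (forall j x, (T ^+ j) x = 0 -> sum E x).
  by exists E.
have [|E1 [nilE1 piE1 EE1 E1x]] :=
  nilpotent_projection_absorb (j := j) (x := x) nilE.
  by rewrite Tjx linear0.
have lin_sum P : linear_set (sum P).
  split; first by exists 0, 0; rewrite !linear0 addr0.
  move=> a _ _ [u [m [Pm ->]]] [u' [m' [Pm' ->]]].
  exists (a *: u + u'), (a *: m + m'); rewrite !linearP /= Pm Pm'.
  by rewrite scalerDr addrACA.
have [||m mn codE1] := codim_le_decrease (lin_sum E) (lin_sum E1) _ _ nsum codE.
- by move=> _ [u [m [Em ->]]]; exists u, m; split=> //; exact: EE1.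
- by exists 0, x; rewrite linear0 add0r.
have [E' [nilE' piE' sat]] := IHk m (leq_trans mn nk) E1 nilE1 codE1.
by exists E'; rewrite piE' piE1.
Qed.

End NilpotentProjections.

(** * Decoupling *)
Section Splitting.
Variables (R : realType) (K : numFieldType) (hK : real_or_complex R K).
Variable X : completeNormedModType K.
Variable T : 'L(X).
Implicit Types f g E P S : 'L(X).
Notation pi := (@frquot_pi K X).

Lemma compression_regular E S :
    E * E = E -> pi T * pi E = pi E * pi T ->
    pi (T * S * (1 - E)) = pi (1 - E) ->
  exists s, let B := (1 - E) * T * (1 - E) in B * s * B = B.
Proof.
move=> EE TE TS; apply: (regular_modulo_finite_rank hK (b := S)).
apply/frquot_piP.
have QQ : (1 - E) * (1 - E) = 1 - E.
  by rewrite mulrBr mulr1 mulrBl mul1r EE subrr subr0.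
have TQ : pi T * pi (1 - E) = pi (1 - E) * pi T.
  by rewrite rmorphB rmorph1 mulrBr mulrBl mulr1 mul1r TE.
have QQpi : pi (1 - E) * pi (1 - E) = pi (1 - E) by rewrite -rmorphM QQ.
move: TS; rewrite !rmorphM /= => TS; set t := pi T in TS TQ *.
set q := pi (1 - E) in TS TQ QQpi *; set s := pi S in TS *.
have -> : q * t * q = q * t by rewrite -mulrA TQ mulrA QQpi.
have -> : q * t * s * (q * t) = q * (t * s * q) * t by rewrite !mulrA.
by rewrite TS QQpi.
Qed.

(** B is the compression of T to ker E, s a generalised inverse of B, and
    C = E T (1 - E) the coupling.  Replacing ker E by the graph of L = D s over
    it changes C into C + T L - L B.  With the finite sum D that solves
    D = C + T D s this is D (1 - s B), which factors through ker B. *)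
Lemma couple_through_kernel E S : nilpotent_projection T E ->
    pi T * pi E = pi E * pi T -> pi (T * S * (1 - E)) = pi (1 - E) ->
  exists E', [/\ E' * E' = E', pi E' = pi E,
    forall x, E' x = x <-> E x = x &
    forall x, exists k, E' k = 0 /\ T k = E' (T (x - E' x))].
Proof.
move=> [EE ETE [n TnE]] TE TS.
have [s0 /= Bs0B] := compression_regular EE TE TS.
set B := (1 - E) * T * (1 - E) in Bs0B.
pose s := (1 - E) * s0 * (1 - E).
have EQ : E * (1 - E) = 0 by rewrite mulrBr mulr1 EE subrr.
have QE : (1 - E) * E = 0 by rewrite mulrBl mul1r EE subrr.
have QQ : (1 - E) * (1 - E) = 1 - E by rewrite mulrBr mulr1 QE subr0.
have BsB : B * s * B = B.
  have BQ : B * (1 - E) = B by rewrite /B -mulrA QQ.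
  have QB : (1 - E) * B = B by rewrite /B !mulrA QQ.
  have -> : B * s * B = (B * (1 - E)) * s0 * ((1 - E) * B) by rewrite /s !mulrA.
  by rewrite BQ QB.
have Es : E * s = 0 by rewrite /s !mulrA EQ !mul0r.
have sE : s * E = 0 by rewrite /s -!mulrA QE !mulr0.
pose C := E * T * (1 - E).
have C_fr : pi C = 0.
  rewrite /C !rmorphM rmorphB rmorph1 /= -TE -mulrA mulrBr mulr1 -rmorphM EE.
  by rewrite subrr mulr0.
have EC : E * C = C by rewrite /C !mulrA EE.
have CE : C * E = 0 by rewrite /C -mulrA QE mulr0.
have TnC : T ^+ n * C = 0 by rewrite -EC mulrA TnE mul0r.
have ET_E i : E * (T ^+ i * E) = T ^+ i * E.
  elim: i => [|i IHi]; first by rewrite mul1r EE.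
  by rewrite exprS -!mulrA -IHi !mulrA ETE.
pose D := \sum_(i < n) T ^+ i * C * s ^+ i.
have DE : D = C + T * D * s.
  have -> : T * D * s = \sum_(i < n) T ^+ i.+1 * C * s ^+ i.+1.
    rewrite mulr_sumr mulr_suml; apply: eq_bigr => i _.
    by rewrite exprS exprSr !mulrA.
  case: n @D TnC {TnE} => [|n] D TnC.
    by move: TnC; rewrite /D !big_ord0 mul1r => ->; rewrite addr0.
  by rewrite /D big_ord_recl big_ord_recr /= TnC mul0r addr0 !mul1r mulr1.
have ED : E * D = D.
  rewrite /D mulr_sumr; apply: eq_bigr => i _.
  by rewrite -EC !mulrA -(mulrA E) ET_E.
have D_E : D * E = 0.
  by rewrite DE mulrDl CE -mulrA sE mulr0 addr0.
have piD : pi D = 0.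
  rewrite /D rmorph_sum big1// => i _.
  by rewrite 2!rmorphM /= C_fr mulr0 mul0r.
pose L := D * s.
have EL : E * L = L by rewrite /L mulrA ED.
have LE : L * E = 0 by rewrite /L -mulrA sE mulr0.
have LL : L * L = 0 by rewrite -{2}EL mulrA LE mul0r.
pose E' := E - L.
have fixE' x : E' x = x <-> E x = x.
  split=> Ex; last first.
    by rewrite bopD bopN Ex (_ : L x = 0) ?subr0// -Ex -[LHS]/((L * E) x) LE.
  by rewrite -Ex -[LHS]/((E * (E - L)) x) mulrBr EE EL.
have T_off z : E z = 0 -> T z = C z + B z.
  move=> Ez; rewrite -bopD; have -> : C + B = T * (1 - E).
    by rewrite /C /B -!mulrDl addrC subrK mul1r.
  by rewrite bopM bopD bopN Ez subr0.
exists E'; split=> //.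
- by rewrite mulrBr !mulrBl EE EL LE LL !subr0.
- by rewrite rmorphB rmorphM /= piD mul0r subr0.
have TLD w : C w + T (L w) = D w.
  by rewrite -[T _]/((T * (D * s)) w) mulrA -bopD -DE.
have EDw w : E (D w) = D w by rewrite -bopM ED.
have LDw w : L (D w) = 0 by rewrite -[LHS]/((L * D) w) -ED mulrA LE mul0r.
have EB w : E (B w) = 0 by rewrite -[LHS]/((E * B) w) /B !mulrA EQ !mul0r.
have E'E w : E' w = E w - L w by [].
move=> x.
have [z [Ez zE]] : exists z, E z = 0 /\ z = x - E x.
  by exists (x - E x); rewrite bopBr idempotent_fixed// subrr.
have [y [Ey yE]] : exists y, E y = 0 /\ y = z - s (B z).
  by exists (z - s (B z)); rewrite bopBr Ez -[E (s _)]/((E * s) (B z)) Es subrr.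
have By : B y = 0 by rewrite yE bopBr -[B (s _)]/((B * s * B) z) BsB subrr.
exists (y + L y); split.
  by rewrite E'E !bopDr Ey -!bopM EL LL bop0 add0r addr0 subrr.
have -> : x - E' x = z + L z.
  rewrite zE E'E bopBr -[L (E x)]/((L * E) x) LE subr0.
  by rewrite opprD opprK addrA.
rewrite [T (y + _)]bopDr [T (z + _)]bopDr (T_off y)// (T_off z)// By addr0 TLD.
have -> : C z + B z + T (L z) = D z + B z by rewrite addrAC TLD.
rewrite E'E [E (_ + _)]bopDr [L (_ + _)]bopDr EB EDw LDw addr0 add0r.
by rewrite yE bopBr.
Qed.

End Splitting.

Section Commuting.
Variables (R : realType) (K : numFieldType) (hK : real_or_complex R K).
Variable X : completeNormedModType K.
Variable T : 'L(X).
Implicit Types f g E P S : 'L(X).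
Notation pi := (@frquot_pi K X).

Lemma linear_set_preimage f (Z : set X) :
  linear_set Z -> linear_set [set x | Z (f x)].
Proof.
move=> [Z0 Zlin]; split; first by rewrite /= bopr0.
by move=> a x y /= Zx Zy; rewrite bopDr bopZr; exact: Zlin.
Qed.

Lemma linear_set_image f (Z : set X) :
  linear_set Z -> linear_set [set f x | x in Z].
Proof.
move=> [Z0 Zlin]; split; first by exists 0; rewrite ?bopr0.
move=> a _ _ [x Zx <-] [y Zy <-]; exists (a *: x + y); first exact: Zlin.
by rewrite bopDr bopZr.
Qed.

Lemma linear_setI (Y Z : set X) :
  linear_set Y -> linear_set Z -> linear_set (Y `&` Z).
Proof.
move=> [Y0 Yl] [Z0 Zl]; split=> // a x y [? ?] [? ?].
by split; [exact: Yl|exact: Zl].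
Qed.

Lemma linear_set_nilspace : linear_set [set x | exists j, (T ^+ j) x = 0].
Proof.
have later j k x : (T ^+ j) x = 0 -> (T ^+ (k + j)) x = 0.
  by move=> Tjx; rewrite exprD bopM Tjx bopr0.
split; first by exists 0%N; rewrite bopr0.
move=> a x y [j Tjx] [k Tky]; exists (j + k)%N.
by rewrite bopDr bopZr {1}addnC !later// scaler0 addr0.
Qed.

(** The smallest T-invariant space containing the range of a finite-rank
    operator C is spanned by the T^i v_j, where the v_j span the range, and only
    finitely many of these are nonzero when T is nilpotent on them. *)
Lemma finite_dim_orbit C n : C \in finite_rank (X := X) -> T ^+ n * C = 0 ->
  exists Z : set X, [/\ finite_dim Z, forall i x, Z ((T ^+ i) (C x)) &
    forall S : set X, linear_set S -> (forall i x, S ((T ^+ i) (C x))) ->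
      Z `<=` S].
Proof.
move=> /asboolP[m [v CE]] TnC.
pose w (k : 'I_#|{: 'I_n * 'I_m}|) := (T ^+ (enum_val k).1) (v (enum_val k).2).
have vC j : exists x, C x = v j.
  have [x _ xv] : range C (v j) by rewrite CE; exact: lspan_mem.
  by exists x.
exists (lspan w); split; first by exists #|{: 'I_n * 'I_m}|, w.
  move=> i x; have linw := linear_set_lspan w.
  have : lspan v (C x) by rewrite -CE; exists x.
  move: (C x); apply: (lspan_sub (linear_set_preimage (T ^+ i) linw)) => j /=.
  have [ni|] := ltnP i n.
    have -> : (T ^+ i) (v j) = w (enum_rank (Ordinal ni, j)).
      by rewrite /w enum_rankK.
    exact: lspan_mem.
  move=> /subnK <-; have [x0 <-] := vC j.
  by rewrite exprD -!bopM -mulrA TnC mulr0; case: linw.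
move=> S linS ST; apply: lspan_sub => // k.
by rewrite /w; have [x <-] := vC (enum_val k).2; exact: ST.
Qed.

(** Here ker E is already T-invariant, and range E is to be replaced by the
    graph of some L from range E to ker E.  The graph is T-invariant when
    L T - T L is G, the block of T from range E to ker E; this is solved by
    L = - sum_i W_(i+1) E T^i, where W_i is an i-fold preimage of G under T, and
    the sum is finite since E T^n = 0. *)
Lemma lower_triangular_splitting E n (V : set X) :
    E * E = E -> E * T * E = E * T -> T ^+ n * E = 0 ->
    linear_set V -> V `<=` [set x | E x = 0] -> V `<=` [set T x | x in V] ->
    (1 - E) * T * E \in finite_rank (X := X) ->
    (forall x, V (((1 - E) * T * E) x)) ->
  exists E', [/\ E' * E' = E', T * E' = E' * T, T ^+ n * E' = 0 & pi E' = pi E].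
Proof.
move=> EE ETE TnE linV VE VTV; set G := (1 - E) * T * E => G_fr GV.
pose in_V (w : 'L(X)) := w \in finite_rank (X := X) /\ forall x, V (w x).
have /choice[lift liftP] w : exists w', in_V w -> in_V w' /\ T * w' = w.
  have [[w_fr wV]|nV] := pselect (in_V w); last by exists 0.
  have [|w' w'_fr [Tw' w'V]] := finite_rank_lift hK (U := T) linV w_fr.
    by move=> x; have [y Vy yE] := VTV _ (wV x); exists y.
  by exists w'.
pose W i := iter i lift G.
have WV i : in_V (W i) by elim: i => // i IHi; exact: (liftP _ IHi).1.
have TW i : T * W i.+1 = W i by exact: (liftP _ (WV i)).2.
have EW i : E * W i = 0 by apply: bopP => x; apply: VE; exact: (WV i).2.
have ETiE i : E * T ^+ i * E = E * T ^+ i.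
  elim: i => [|i IHi]; first by rewrite mulr1 EE.
  by rewrite exprS mulrA -ETE -!mulrA [E * (T ^+ i * E)]mulrA IHi.
have ETn : E * T ^+ n = 0 by rewrite -ETiE -mulrA TnE mulr0.
pose L := - \sum_(i < n) W i.+1 * E * T ^+ i.
have TL : T * L = - \sum_(i < n) W i * E * T ^+ i.
  rewrite mulrN mulr_sumr; congr (- _); apply: eq_bigr => i _.
  by rewrite -[in RHS]TW !mulrA.
have LT : L * T = - \sum_(i < n) W i.+1 * E * T ^+ i.+1.
  rewrite mulNr mulr_suml; congr (- _); apply: eq_bigr => i _.
  by rewrite exprSr !mulrA.
have TL_LT : T * L - L * T = - G.
  pose a i := W i * E * T ^+ i.
  rewrite TL LT opprK addrC -sumrB -(big_mkord predT (fun i => a i.+1 - a i)).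
  rewrite telescope_sumr// /a -[W n * E * _]mulrA ETn mulr0 sub0r mulr1.
  by rewrite -[W 0%N]/G /G -!mulrA EE.
have EL : E * L = 0.
  rewrite mulrN mulr_sumr big1 ?oppr0// => i _.
  by rewrite !mulrA EW !mul0r.
have LE : L * E = L.
  rewrite mulNr mulr_suml; congr (- _); apply: eq_bigr => i _.
  by rewrite -!mulrA [E * (_ * E)]mulrA ETiE.
have LL : L * L = 0 by rewrite -{1}LE -mulrA EL mulr0.
have TE : T * E = E * T + G.
  by rewrite /G -ETE -mulrDl -mulrDl addrC subrK mul1r.
have EpL_T : (E + L) * T = T * (E + L).
  rewrite mulrDl mulrDr TE -addrA; congr (_ + _).
  by rewrite -[G]opprK -TL_LT opprB subrK.
exists (E + L); split=> //.
- by rewrite mulrDr !mulrDl EE EL LE LL !addr0.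
- have -> : T ^+ n * (E + L) = (E + L) * T ^+ n.
    by rewrite (commrX n (EpL_T : GRing.comm _ _)).
  have -> : E + L = (E + L) * E by rewrite mulrDl EE LE.
  by rewrite -mulrA ETn mulr0.
- rewrite rmorphD /= (_ : pi L = 0) ?addr0//; apply/frquot_pi_eq0.
  rewrite rpredN; apply: rpred_sum => i _.
  by rewrite -mulrA; apply: finite_rankMr; exact: (WV _).1.
Qed.

(** Let Z be the T-invariant space generated by range C, where C = E T (1 - E).
    Then N' = Z + ker E, which is the set of x with E x in Z, is T-invariant and
    becomes the new kernel.  The vectors of N' killed by a power of T form a
    space V with V = T V: the generators of Z have preimages in V by the
    hypothesis on E (T (x - E x)), and a vector of ker E killed by a power of T
    is T u + m with m in range E, where the same hypothesis allows u to be
    corrected within ker E so as to cancel m. *)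
Lemma commuting_projection E : nilpotent_projection T E ->
    pi T * pi E = pi E * pi T ->
    (forall x, exists k, E k = 0 /\ T k = E (T (x - E x))) ->
    (forall j x, (T ^+ j) x = 0 -> exists u m, E m = m /\ x = T u + m) ->
  exists E', [/\ E' * E' = E', T * E' = E' * T, exists n, T ^+ n * E' = 0 &
    pi E' = pi E].
Proof.
move=> [EE ETE [n TnE]] TE coupling saturated.
have EX x : E (E x) = E x by exact: idempotent_fixed.
pose C := E * T * (1 - E).
have CE x : C x = E (T (x - E x)) by [].
have C_fr : C \in finite_rank (X := X).
  apply/frquot_pi_eq0.
  rewrite /C !rmorphM rmorphB rmorph1 /= -TE -mulrA mulrBr mulr1 -rmorphM EE.
  by rewrite subrr mulr0.
have TnC : T ^+ n * C = 0 by rewrite /C !mulrA TnE !mul0r.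
have [Z [finZ ZC Zmin]] := finite_dim_orbit C_fr TnC.
have linZ : linear_set Z by have [m [v ->]] := finZ; exact: linear_set_lspan.
have ET x : E x = x -> E (T x) = T x.
  by move=> Ex; rewrite -Ex -[LHS]/((E * T * E) x) ETE.
have ETE' x : E (T (E x)) = T (E x) by exact: ET.
have ETi i x : E x = x -> E ((T ^+ i) x) = (T ^+ i) x.
  by move=> Ex; elim: i => // i IHi; rewrite exprS bopM ET.
have EZ z : Z z -> E z = z.
  have : linear_set [set z | E z = z].
    split; first exact: bopr0.
    by move=> a x y /= Ex Ey; rewrite bopDr bopZr Ex Ey.
  move=> /Zmin; apply=> i x; apply: ETi.
  by rewrite CE EX.
have TZ z : Z z -> Z (T z).
  apply: Zmin (linear_set_preimage T linZ) _ z => i x /=.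
  by have := ZC i.+1 x; rewrite exprS.
pose N' := [set x | Z (E x)].
have linN' : linear_set N' := linear_set_preimage E linZ.
have TN' x : N' x -> N' (T x).
  rewrite /N' /= => Zx.
  have -> : E (T x) = T (E x) + C x.
    by rewrite CE bopBr bopBr ETE' addrC subrK.
  apply: linear_setD => //; first exact: TZ.
  exact: (ZC 0%N).
have TiN' i x : N' x -> N' ((T ^+ i) x).
  by move=> N'x; elim: i => // i IHi; rewrite exprS bopM; exact: TN'.
have kerN' x : E x = 0 -> N' x by rewrite /N' /= => ->; case: linZ.
pose V := N' `&` [set x | exists j, (T ^+ j) x = 0].
have linV : linear_set V := linear_setI linN' linear_set_nilspace.
have TnZ z : Z z -> (T ^+ n) z = 0.
  by move=> /EZ <-; rewrite -bopM TnE.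
have ZV : Z `<=` V.
  by move=> z Zz; split; [rewrite /N' /= EZ|exists n; exact: TnZ].
have ZTV : Z `<=` [set T x | x in V].
  apply: Zmin => [|i x]; first exact: linear_set_image.
  have [k [Ek Tk]] := coupling x.
  exists ((T ^+ i) k); last by rewrite -bopM -exprS exprSr bopM Tk.
  split; first by apply: TiN'; exact: kerN'.
  exists n.+1; rewrite -bopM -exprD addSn addnC exprSr exprD !bopM.
  by rewrite Tk -[(T ^+ n) _]/((T ^+ n * C) x) TnC bopr0.
have VTV : V `<=` [set T x | x in V].
  move=> x [N'x [j Tjx]]; rewrite -(subrK (E x) x).
  apply: linear_setD; [exact: linear_set_image| |exact: ZTV].
  set y := x - E x.
  have Ey : E y = 0 by rewrite /y bopBr EX subrr.
  have Ty : (T ^+ (j + n)) y = 0.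
    by rewrite bopBr {1}addnC !exprD !bopM Tjx (TnZ (E x))// !bopr0 subrr.
  have [u [m [Em yE]]] := saturated _ _ Ty.
  have [k [Ek Tk]] := coupling u.
  have yT : y = T (u - E u - k).
    have mE : m = - T (E u) - T k.
      apply/eqP; rewrite -subr_eq0 opprD !opprK; apply/eqP; rewrite -[RHS]Ey yE.
      rewrite bopDr Em Tk !bopBr ETE'.
      by rewrite [T (E u) + _]addrC subrK addrC.
    by rewrite {1}yE mE !bopBr addrA.
  exists (u - E u - k) => //; split.
    by apply: kerN'; rewrite !bopBr EX subrr Ek subrr.
  by exists (j + n).+1; rewrite exprSr bopM -yT.
have [q0 q0_fr [q0Z Zq0]] := finite_dim_projection hK finZ.
pose q := q0 * E.
have q_fr : q \in finite_rank (X := X) by exact: finite_rankMr.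
have qZ x : Z (q x) by exact: q0Z.
have Zq z : Z z -> q z = z by move=> Zz; rewrite bopM EZ// Zq0.
pose E1 := E - q.
have E1E x : E1 x = E x - q x by [].
have E1N' x : N' x -> E1 x = 0.
  by move=> N'x; rewrite E1E -[q x]/(q0 (E x)) Zq0 ?subrr.
have N'E1 x : N' (x - E1 x).
  suff Eq : E (x - E1 x) = q x by rewrite /N' /mkset Eq.
  by rewrite E1E opprD opprK addrA bopDr bopBr EX subrr add0r EZ.
have E1_idem : E1 * E1 = E1.
  apply: bopP => x; rewrite bopM -[in LHS](subrK x (E1 x)).
  by rewrite bopDr -opprB -scaleN1r bopZr E1N'// scaler0 add0r.
have EE1 : E * E1 = E1.
  by apply: bopP => x; rewrite bopM E1E bopBr EX (EZ _ (qZ x)).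
have GE : (1 - E1) * (T * E1) = q * (T * E1).
  rewrite /E1 opprB addrA addrC addrA [- E + 1]addrC mulrDl.
  have -> : (1 - E) * (T * E1) = 0; last by rewrite add0r.
  have QE : (1 - E) * E = 0 by rewrite mulrBl mul1r EE subrr.
  have QTE : (1 - E) * (T * E) = 0 by rewrite -ETE !mulrA QE !mul0r.
  by rewrite -EE1 [T * _]mulrA mulrA QTE mul0r.
have [||||||E' [E'E' TE' TnE' piE']] :=
    @lower_triangular_splitting E1 n V E1_idem _ _ linV.
- apply: bopP => x; apply/esym; rewrite !bopM -[in LHS](subrK (E1 x) x).
  by rewrite 2!bopDr E1N' ?add0r//; apply: TN'; exact: N'E1.
- by rewrite -EE1 mulrA TnE mul0r.
- by move=> x [N'x _]; exact: E1N'.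
- exact: VTV.
- rewrite -mulrA GE; exact: finite_rankMr.
- by move=> x; rewrite -mulrA GE; apply: ZV; exact: qZ.
exists E'; split=> //; first by exists n.
by rewrite piE' rmorphB /= (_ : pi q = 0) ?subr0//; exact/frquot_pi_eq0.
Qed.

End Commuting.

(** * The equivalence *)
Section Equivalence.
Variables (R : realType) (K : numFieldType) (hK : real_or_complex R K).
Variable X : completeNormedModType K.
Variable T : 'L(X).
Implicit Types f g E P S : 'L(X).
Notation pi := (@frquot_pi K X).

Lemma bop_restrict_exp (M : closed_subspace X) (TM : bop_invariant M T) n
    (x : csub M) : val ((bop_restrict TM ^+ n) x) = (T ^+ n) (val x).
Proof.
elim: n x => // n IHn x.
by rewrite exprSr bopM IHn exprSr bopM.
Qed.

(** The right inverse S of T modulo finite rank, cut down to ker E by 1 - E on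
    the left, remains a right inverse of T on ker E, since T commutes with E. *)
Lemma decomposition_of_projection E S n :
    E * E = E -> T * E = E * T -> T ^+ n * E = 0 ->
    pi (T * S * (1 - E)) = pi (1 - E) ->
  nilpotent_right_semi_Fredholm T.
Proof.
move=> EE TE TnE TS.
have lin_ker f : linear_set [set x | f x = 0].
  split=> [|a x y /= fx fy]; first exact: bopr0.
  by rewrite bopDr bopZr fx fy scaler0 addr0.
have [M ME] := closed_linear_set (lin_ker (1 - E)) (closed_ker (f := 1 - E)).
have [N NE] := closed_linear_set (lin_ker E) (closed_ker (f := E)).
have NP x : reflect (E x = 0) (x \in csub_pred N).
  by rewrite NE; apply: (iffP idP) => [/set_mem|Ex]; last exact: mem_set.
have MP x : reflect (E x = x) (x \in csub_pred M).
  rewrite ME; apply: (iffP idP) => [/set_mem /= /eqP|Ex].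
    by rewrite subr_eq0 eq_sym => /eqP.
  by apply: mem_set; rewrite /= Ex subrr.
have TEx x : T (E x) = E (T x) by rewrite -[LHS]/((T * E) x) TE.
have TM : bop_invariant M T by move=> x /MP Ex; apply/MP; rewrite -TEx Ex.
have TN : bop_invariant N T by move=> x /NP Ex; apply/NP; rewrite -TEx Ex bopr0.
have QN x : x - E x \in csub_pred N.
  by apply/NP; rewrite bopBr idempotent_fixed// subrr.
exists M, N, TM, TN; split.
- split=> [x|x /MP Ex /NP]; last by rewrite Ex.
  exists (E x); first by apply/MP; exact: idempotent_fixed.
  by exists (x - E x); rewrite // addrC subrK.
- exists n; apply: bopP => x; apply: val_inj; rewrite bop_restrict_exp.
  have /MP Ex := csub_valP x.
  transitivity ((T ^+ n * E) (csub_val x)); first by rewrite bopM Ex.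
  by rewrite TnE.
pose b0 := (1 - E) * S.
pose b (x : csub N) : csub N := Csub (QN (S (csub_val x))).
have linb : linear b.
  by move=> a x y; apply: val_inj; rewrite /= -![_ - E _]/(b0 _) !linearP.
have boundb : bounded_op b.
  have [C b0C] := bop_bounded b0; exists C => x; exact: b0C.
apply: (right_semi_Fredholm_of_right_inverse hK (b := Bop linb boundb)).
have /finite_rankP[m [v vE]] :
    T * (b0 * (1 - E)) - (1 - E) \in finite_rank (X := X).
  apply/frquot_piP; rewrite -TS.
  have -> : T * (b0 * (1 - E)) = (1 - E) * (T * S * (1 - E)).
    rewrite /b0 !mulrA; congr (_ * _ * _).
    by rewrite mulrBr mulrBl mulr1 mul1r TE.
  rewrite [LHS]rmorphM /= TS -rmorphM mulrBr mulr1 mulrBl mul1r EE.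
  by rewrite subrr subr0.
apply/finite_rankP; exists m, (fun i => Csub (QN (v i))) => _ [x _ <-].
have /NP Ex := csub_valP x.
have [|c _ cE] := vE (T (b0 (csub_val x)) - csub_val x).
  by exists (csub_val x) => //; rewrite !bopE Ex subr0.
exists c => //; apply: val_inj; rewrite [LHS]raddf_sum /=.
have : \sum_i c i *: (v i - E (v i)) = (1 - E) (\sum_i c i *: v i).
  by rewrite linear_sum; apply: eq_bigr => i _; rewrite linearZ.
rewrite cE.
have -> : (1 - E) (T (b0 (csub_val x)) - csub_val x) =
    T (b0 (csub_val x)) - csub_val x.
  have Eb0 : E * b0 = 0 by rewrite /b0 mulrA mulrBr mulr1 EE subrr mul0r.
  have Ey : E (T (b0 (csub_val x)) - csub_val x) = 0.
    rewrite [LHS]bopBr Ex -TEx -[E _]/((E * b0) (csub_val x)) Eb0.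
    by rewrite bopr0 subrr.
  by rewrite [LHS]bopD bopN Ey subr0.
by move=> <-; apply: eq_bigr.
Qed.

Lemma nilpotent_right_semi_Fredholm_of_right_semi_B_Fredholm :
  right_semi_B_Fredholm T -> nilpotent_right_semi_Fredholm T.
Proof.
move=> [p [pp [Tp [s sp Ts]] [n Tpn]]].
have [S sE] := frquot_pi_surj s; rewrite {s}sE in sp Ts.
have Tpn1 : (pi T * p) ^+ n.+1 = 0 by rewrite exprSr Tpn mul0r.
have TS : pi T * pi S * (1 - p) = 1 - p.
  have pSp : p * pi S * (1 - p) = 0.
    by rewrite -[p * pi S]sp -mulrA mulrBr mulr1 pp subrr mulr0.
  transitivity ((pi T + p) * pi S * (1 - p)); last by rewrite Ts mul1r.
  by rewrite [(_ + p) * _]mulrDl [RHS]mulrDl pSp addr0.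
have [E0 nilE0 piE0] := nilpotent_projection_lift hK pp Tp Tpn1.
have TSE (E : 'L(X)) : pi E = p -> pi (T * S * (1 - E)) = pi (1 - E).
  by move=> piE; rewrite !rmorphM !rmorphB !rmorph1 /= piE TS.
have [|E1 [nilE1 piE1 sat1]] := nilpotent_projection_saturate hK nilE0.
  have /frquot_piP/finite_rankP[m [v vE]] := TSE _ piE0.
  exists m, v => y; exists (T (S (y - E0 y)) + E0 y).
    exists (S (y - E0 y)), (E0 y); split=> //.
    by case: nilE0 => EE _ _; exact: idempotent_fixed.
  have := vE ((T * S * (1 - E0) - (1 - E0)) y) (ex_intro2 _ _ y I erefl).
  move=> /(linear_setZ (-1) (linear_set_lspan v)).
  by rewrite scaleN1r !bopE opprB opprD addrA addrAC.
have piE1p : pi E1 = p by rewrite piE1.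
have TE1 : pi T * pi E1 = pi E1 * pi T by rewrite piE1p; exact: Tp.
have [E2 [E2E piE2 fixE2 coupling]] :=
  couple_through_kernel hK nilE1 TE1 (TSE _ piE1p).
have nilE2 : nilpotent_projection T E2.
  have [E1E _ _] := nilE1.
  have [inv [k nil]] := (nilpotent_projectionP T E1E).1 nilE1.
  apply/nilpotent_projectionP => //; split=> [x /fixE2 Ex|].
    by apply/fixE2; exact: inv.
  by exists k => x /fixE2; exact: nil.
have [||E3 [E3E TE3 [k TkE3] piE3]] := commuting_projection hK nilE2 _ coupling.
- by rewrite piE2 piE1p.
- move=> j x /sat1[u [m [Em ->]]]; exists u, m; split=> //.
  exact/fixE2.
apply: (decomposition_of_projection (S := S) E3E TE3 TkE3).
by apply: TSE; rewrite piE3 piE2.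
Qed.

(** On N the right inverse is that of T|N; on M, T + 1 is inverted by the sum of
    the powers of - T. *)
Lemma right_semi_B_Fredholm_of_nilpotent_right_semi_Fredholm :
  nilpotent_right_semi_Fredholm T -> right_semi_B_Fredholm T.
Proof.
move=> [M [N [TM [TN [MN [n Tn0] RF]]]]].
have [E [EM EN EMid EN0]] := direct_sum_projection hK MN.
have EE : E * E = E by apply: bopP => x; exact: EMid.
have TE : T * E = E * T.
  apply: bopP => x; rewrite !bopM -{2}(subrK (E x) x) 2!bopDr.
  by rewrite (EN0 _ (TN _ (EN x))) (EMid _ (TM _ (EM x))) add0r.
have TnE : T ^+ n * E = 0.
  apply: bopP => x; rewrite bopM.
  by rewrite -(bop_restrict_exp TM n (Csub (EM x))) Tn0.
have [b Tb] := right_inverse_of_right_semi_Fredholm hK RF.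
pose b0f x := csub_val (b (Csub (EN x))).
have linb0 : linear b0f.
  move=> a x y; rewrite /b0f.
  rewrite -[RHS]/(csub_val (a *: b (Csub (EN x)) + b (Csub (EN y)))).
  rewrite -bopZr -bopDr; congr (csub_val (b _)); apply: val_inj => /=.
  by rewrite bopDr bopZr opprD addrACA scalerBr.
have boundb0 : bounded_op b0f.
  have [C C0 bC] := bop_bound b; have [D D0 QD] := bop_bound (1 - E).
  exists (C * D) => x; rewrite (le_trans (bC _))// -mulrA ler_wpM2l//.
  exact: (QD x).
pose b0 : 'L(X) := Bop linb0 boundb0.
have b0N x : b0 x \in csub_pred N by exact: csub_valP.
have Eb0 : E * b0 = 0 by apply: bopP => x; exact: EN0.
have b0E : b0 * E = 0.
  apply: bopP => x; rewrite bopM /= /b0f.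
  have -> : Csub (EN (E x)) = 0.
    by apply: val_inj; rewrite /= (EMid _ (EM x)) subrr.
  by rewrite bopr0.
have Tb0 : pi (T * b0) = pi (1 - E).
  apply/frquot_piP; move/finite_rankP: Tb => [m [v vE]].
  apply/finite_rankP; exists m, (fun i => csub_val (v i)) => _ [x _ <-].
  have [|c _ cE] := vE ((bop_restrict TN * b - 1) (Csub (EN x))).
    by exists (Csub (EN x)).
  exists c => //.
  have := congr1 (@csub_val _ _ N) cE.
  by rewrite -[csub_val (\sum_i _)]/(val _) raddf_sum.
pose G : 'L(X) := \sum_(i < n) (- T) ^+ i.
have GE : G * E = E * G.
  rewrite mulr_suml mulr_sumr; apply: eq_bigr => i _.
  by apply/commr_sym/commrX/commr_sym; rewrite /GRing.comm mulNr mulrN TE.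
have TGE : (T + 1) * (G * E) = E.
  have TG : (T + 1) * G = 1 - (- T) ^+ n.
    have := subrX1 (- T) n; rewrite -/G => e.
    by rewrite -[1 - _]opprB e -mulNr opprB opprK addrC.
  by rewrite mulrA TG mulrBl mul1r exprNn -mulrA TnE mulr0 subr0.
pose c := b0 + G * E.
have cE : c * E = E * c.
  by rewrite /c mulrDl mulrDr b0E Eb0 -mulrA EE mulrA -GE -mulrA EE.
exists (pi E); split.
- by rewrite -rmorphM EE.
- split; first by rewrite /GRing.comm -!rmorphM TE.
  exists (pi c); first by rewrite /= /commutant /= /GRing.comm -!rmorphM cE.
  have -> : (pi T + pi E) * pi c = pi (T * b0 + E).
    rewrite -rmorphD -rmorphM; congr (pi _).
    rewrite mulrDr mulrDl Eb0 addr0; congr (_ + _).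
    have EGE : E * (G * E) = G * E by rewrite mulrA -GE -mulrA EE.
    by rewrite mulrDl EGE -[X in _ + X]mul1r -mulrDl TGE.
  by rewrite rmorphD /= Tb0 -rmorphD /= subrK rmorph1.
- exists n.+1; rewrite -rmorphM -rmorphXn exprMn_comm//.
  have -> : T ^+ n.+1 * E ^+ n.+1 = T * (T ^+ n * E) * E ^+ n.
    by rewrite !exprS !mulrA.
  by rewrite TnE mulr0 mul0r rmorph0.
Qed.

End Equivalence.

Theorem theorem3p7 (R : realType) (K : numFieldType)
    (hK : real_or_complex R K) (X : completeNormedModType K) (T : 'L(X)) :
  right_semi_B_Fredholm T <-> nilpotent_right_semi_Fredholm T.
Proof.
split.
  exact: (nilpotent_right_semi_Fredholm_of_right_semi_B_Fredholm hK).
exact: (right_semi_B_Fredholm_of_nilpotent_right_semi_Fredholm hK).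
Qed.
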